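(* Let $T$ be a complete NIP theory with monster model $\mathfrak{C}$, let $\tilde{G}$ be a definable group of $T$, and let $G\leqslant\tilde{G}$ be a type-definable subgroup (over a small parameter set) which is dp-minimal. Suppose there is a global type $q\in S(\mathfrak{C})$ which is concentrated on $G^{00}$, is bi-f-generic for $G$, and whose realizations are non-torsion (i.e. have infinite order). Then $G$ is nilpotent-by-finite of class at most $2$, i.e. $G$ has a finite-index subgroup that is nilpotent of class at most $2$.
   Context: ''Small'' and ''bounded'' mean of cardinality less than the degree of saturation of $\mathfrak{C}$. A type-definable group $G$ is identified with the abstract group $G(\mathfrak{C})$. Dp-minimal: sequences $I_1,I_2$ are mutually indiscernible over $B$ if each is indiscernible over $B$ together with the other. $G$ is dp-minimal if for some (equivalently any) small set $B$ over which $G$ is type-defined, for any infinite sequences $I_1,I_2$ mutually indiscernible over $B$ and any $a\in G$, one of $I_1,I_2$ is indiscernible over $B\cup\{a\}$. $G^{00}$ is the smallest subgroup of $G$ of bounded index that is type-definable over a small set of parameters (it exists since $T$ is NIP, and is normal in $G$). A global type is concentrated on a type-definable set if it implies membership in that set; its realizations are taken in an elementary extension of $\mathfrak{C}$. f-generic: a partial type $\pi(x)$ over a small set, concentrated on $\tilde{G}$, is left (resp. right) f-generic for $G$ if, for any small model $M$ over which $\pi$ and $G$ are type-definable, no left (resp. right) translate of the partial type $\pi(x)\wedge G(x)$ by an element of $G$ forks over $M$. A global type is left (resp. right) f-generic for $G$ if all its restrictions to small sets are. (Known fact: a global type concentrated on $G$ is left, resp. right, f-generic for $G$ if and only if it is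 invariant under left, resp. right, translation by elements of $G^{00}(\mathfrak{C})$.) Bi-f-generic means both left and right f-generic. *)

(* Defs.v *)
From HB Require Import structures.
From mathcomp Require Import all_boot all_order.
From mathcomp Require Import mathcomp_extra boolp classical_sets functions.
From mathcomp Require Import cardinality.

Set Implicit Arguments.
Unset Strict Implicit.
Unset Printing Implicit Defensive.

Local Open Scope classical_set_scope.
Local Open Scope card_scope.

Record language := Language {
  fun_symb : Type;
  fun_arity : fun_symb -> nat;
  rel_symb : Type;
  rel_arity : rel_symb -> nat
}.

Inductive term (L : language) (V : Type) : Type :=
| Var of V
| App (f : fun_symb L) of ('I_(fun_arity f) -> term L V).

(* The variables are the elements of an arbitrary type [V].  The body of a
   quantifier has variables in [option V], and [None] is the bound one. *)
Inductive formula (L : language) (V : Type) : Type :=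
| Bot
| Eq of term L V & term L V
| Rel (r : rel_symb L) of ('I_(rel_arity r) -> term L V)
| Imp of formula L V & formula L V
| All of formula L (option V).

Arguments Bot {L V}.

Definition Neg L (V : Type) (phi : formula L V) : formula L V := Imp phi Bot.

Fixpoint term_fv L (V : Type) (t : term L V) : set V :=
  match t with
  | Var v => [set v]
  | App _ ts => [set v | exists i, term_fv (ts i) v]
  end.

Fixpoint fv L (V : Type) (phi : formula L V) : set V :=
  match phi with
  | Bot => set0
  | Eq t u => term_fv t `|` term_fv u
  | Rel _ ts => [set v | exists i, term_fv (ts i) v]
  | Imp phi psi => fv phi `|` fv psi
  | All phi => [set v | fv phi (Some v)]
  end.

Record structure (L : language) := Structure {
  carrier :> Type;
  carrier_inhabited : inhabited carrier;
  fun_interp : forall f : fun_symb L,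
    ('I_(fun_arity f) -> carrier) -> carrier;
  rel_interp : forall r : rel_symb L, set ('I_(rel_arity r) -> carrier)
}.

Fixpoint eval L (M : structure L) (V : Type) (e : V -> M) (t : term L V) : M :=
  match t with
  | Var v => e v
  | App _ ts => fun_interp (fun i => eval e (ts i))
  end.

Fixpoint sat L (M : structure L) (V : Type) (phi : formula L V) :
    (V -> M) -> Prop :=
  match phi with
  | Bot => fun _ => False
  | Eq t u => fun e => eval e t = eval e u
  | Rel r ts => fun e => @rel_interp L M r (fun i => eval e (ts i))
  | Imp phi psi => fun e => sat phi e -> sat psi e
  | All phi => fun e => forall x : M,
      sat phi (fun v => if v is Some w then e w else x)
  end.

Definition models L (M : structure L) (T : set (formula L void)) : Prop :=
  forall phi, T phi -> sat phi (of_void M).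

Definition entails L (T : set (formula L void)) (phi : formula L void) : Prop :=
  forall M : structure L, models M T -> sat phi (of_void M).

Definition complete_theory L (T : set (formula L void)) : Prop :=
  (exists M : structure L, models M T) /\
  (forall phi, entails T phi \/ entails T (Neg phi)).

(* The tuple [x] followed by the tuple [y]. *)
Definition cat_env (V W X : Type) (x : V -> X) (y : W -> X) : V + W -> X :=
  fun v => match v with inl i => x i | inr j => y j end.

Definition shatters L (M : structure L) m k N (phi : formula L ('I_m + 'I_k))
    (a : 'I_N -> 'I_m -> M) : Prop :=
  exists b : {set 'I_N} -> 'I_k -> M,
    forall i (S : {set 'I_N}), sat phi (cat_env (a i) (b S)) <-> i \in S.

Definition NIP L (T : set (formula L void)) : Prop :=
  forall M : structure L, models M T ->
  forall m k (phi : formula L ('I_m + 'I_k)),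
  exists N, forall a : 'I_N -> 'I_m -> M, ~ shatters phi a.

(* A formula in variables [V] with parameters in [M] is a formula in variables
   [V + M], where the variable [inr a] stands for the constant [a]. *)

Definition over L (M : structure L) (V : Type) (A : set M)
    (phi : formula L (V + M)) : Prop :=
  forall a, fv phi (inr a) -> A a.

Definition definable L (M : structure L) (V : Type) (A : set M)
    (X : set (V -> M)) : Prop :=
  exists2 phi : formula L (V + M),
    over A phi & X = [set x | sat phi (cat_env x id)].

(* [j : M -> N] interprets the parameters: it is [id] for a realization in [M]
   itself, and the embedding for a realization in an elementary extension. *)
Definition realizes L (M N : structure L) (V : Type) (j : M -> N) (x : V -> N)
    (p : set (formula L (V + M))) : Prop :=
  forall phi, p phi -> sat phi (cat_env x j).

Definition realizations L (M : structure L) (V : Type)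
    (p : set (formula L (V + M))) : set (V -> M) :=
  [set x | realizes id x p].

Definition finitely_satisfiable L (M : structure L) (V : Type)
    (p : set (formula L (V + M))) : Prop :=
  forall p0, finite_set p0 -> p0 `<=` p -> realizations p0 !=set0.

Definition type_definable L (M : structure L) (V : Type) (A : set M)
    (X : set (V -> M)) : Prop :=
  exists2 p : set (formula L (V + M)),
    (forall phi, p phi -> over A phi) & X = realizations p.

Definition same_type L (M : structure L) (V : Type) (A : set M)
    (x y : V -> M) : Prop :=
  forall phi : formula L (V + M), over A phi ->
    sat phi (cat_env x id) <-> sat phi (cat_env y id).

Definition restriction L (M : structure L) (V : Type)
    (q : set (formula L (V + M))) (A : set M) : set (formula L (V + M)) :=
  [set phi | q phi /\ over A phi].

Definition global_type L (M : structure L) (V : Type)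
    (q : set (formula L (V + M))) : Prop :=
  finitely_satisfiable q /\ (forall phi, q phi \/ q (Neg phi)).

(* Elements of [M] serve as variables, so that [sat phi id] says that [M]
   satisfies the sentence [phi] with parameters in [M]. *)
Definition elementary L (M N : structure L) (j : M -> N) : Prop :=
  forall phi : formula L M, sat phi id <-> sat phi j.

Definition elementary_submodel L (M : structure L) (A : set M) : Prop :=
  exists (N : structure L) (j : N -> M), elementary j /\ A = range j.

Definition automorphism L (M : structure L) (s : M -> M) : Prop :=
  [/\ bijective s,
      forall f xs, s (@fun_interp L M f xs) = @fun_interp L M f (s \o xs)
    & forall r xs, @rel_interp L M r xs <-> @rel_interp L M r (s \o xs)].

(* A cardinal is given by a type [K] of that cardinality. *)

Definition small (K U : Type) (X : set U) : Prop :=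
  (X #<= [set: K]) /\ ~ ([set: K] #<= X).

Definition strong_limit (K : Type) : Prop :=
  forall A : set K, small K A -> small K [set B : set K | B `<=` A].

Definition saturated (K : Type) L (M : structure L) : Prop :=
  forall n (A : set M) (p : set (formula L ('I_n + M))),
    small K A -> (forall phi, p phi -> over A phi) ->
    finitely_satisfiable p -> realizations p !=set0.

Definition strongly_homogeneous (K : Type) L (M : structure L) : Prop :=
  forall (A : set M) (f : M -> M), small K A ->
    (forall phi : formula L M, fv phi `<=` A -> (sat phi id <-> sat phi f)) ->
  exists2 s, automorphism s & {in A, s =1 f}.

(* [formula L nat] has the cardinality of the theory, max(|L|, aleph_0). *)
Definition monster (K : Type) L (M : structure L) : Prop :=
  [/\ small K [set: formula L nat], strong_limit K,
      saturated K M & strongly_homogeneous K M].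

Definition indiscernible L (M : structure L) d (J : orderType d) (V : Type)
    (A : set M) (a : J -> V -> M) : Prop :=
  forall k (s t : 'I_k -> J),
    (forall i i' : 'I_k, (i < i')%N -> (s i < s i')%O) ->
    (forall i i' : 'I_k, (i < i')%N -> (t i < t i')%O) ->
    same_type A (fun iv : 'I_k * V => a (s iv.1) iv.2)
                (fun iv : 'I_k * V => a (t iv.1) iv.2).

Definition entries L (M : structure L) (J V : Type) (a : J -> V -> M) : set M :=
  [set c | exists i v, a i v = c].

Definition mutually_indiscernible L (M : structure L) d1 d2
    (J1 : orderType d1) (J2 : orderType d2) (V1 V2 : Type) (B : set M)
    (a1 : J1 -> V1 -> M) (a2 : J2 -> V2 -> M) : Prop :=
  indiscernible (B `|` entries a2) a1 /\ indiscernible (B `|` entries a1) a2.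

(* The formula psi(x, b), here identified with the set that it defines, divides
   over [A] if some (b_i) of realizations of tp(b/A) makes (psi(x, b_i))_i
   k-inconsistent for some k. *)
Definition divides L (M : structure L) (V : Type) (A : set M)
    (D : set (V -> M)) : Prop :=
  exists m (psi : formula L (V + 'I_m)) (b : 'I_m -> M),
    D = [set x | sat psi (cat_env x b)] /\
    exists k (bs : nat -> 'I_m -> M),
      (forall i, same_type A (bs i) b) /\
      (forall s : 'I_k -> nat, injective s ->
        ~ exists x : V -> M, forall i, sat psi (cat_env x (bs (s i)))).

(* Forking over [A] of a partial type over a small set, given by the set [X] of
   its realizations in the monster model. *)
Definition forks L (M : structure L) (V : Type) (A : set M)
    (X : set (V -> M)) : Prop :=
  exists r (D : 'I_r -> set (V -> M)),
    (forall i, divides A (D i)) /\ X `<=` [set x | exists i, D i x].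

Definition subgroup (gT : groupType) (H : set gT) : Prop :=
  group_closed (mem H).

Definition cosets (gT : groupType) (G H : set gT) : set (set gT) :=
  [set [set (g * h)%g | h in H] | g in G].

Definition gen_subgroup (gT : groupType) (X : set gT) : set gT :=
  [set x | forall H, subgroup H -> X `<=` H -> H x].

Fixpoint lower_central (gT : groupType) (H : set gT) (c : nat) : set gT :=
  if c is c'.+1
  then gen_subgroup [set [~ x, y]%g | x in lower_central H c' & y in H]
  else H.

Definition nilpotent_class_le (gT : groupType) (c : nat) (H : set gT) : Prop :=
  lower_central H c `<=` [set 1%g].

Definition nilpotent_by_finite_class_le (gT : groupType) (c : nat)
    (G : set gT) : Prop :=
  exists H : set gT, [/\ subgroup H, H `<=` G, finite_set (cosets G H)
    & nilpotent_class_le c H].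

(* A group of [n]-tuples of [M], definable with parameters, whose abstract group
   of points in [M] is [gT]. *)
Record definable_group L (M : structure L) (gT : groupType) (n : nat) :=
  DefinableGroup {
  pt : gT -> 'I_n -> M;
  pt_inj : injective pt;
  dom : formula L ('I_n + M);
  mul : formula L ('I_n + 'I_n + 'I_n + M);
  domP : forall x, sat dom (cat_env x id) <-> exists g, pt g = x;
  mulP : forall x y z, sat mul (cat_env (cat_env (cat_env x y) z) id) <->
    exists g h, [/\ pt g = x, pt h = y & pt (g * h)%g = z]
}.

(* Type-definability of [G] over [A] includes definability over [A] of the
   ambient group, which is automatic when no parameters occur in [D]. *)
Definition group_over L (M : structure L) gT n (D : definable_group M gT n)
    (A : set M) (G : set gT) : Prop :=
  [/\ definable A [set x | sat (dom D) (cat_env x id)],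
      definable A [set xyz | sat (mul D) (cat_env xyz id)]
    & type_definable A (pt D @` G)].

Definition type_definable_subgroup (K : Type) L (M : structure L) gT n
    (D : definable_group M gT n) (G : set gT) : Prop :=
  subgroup G /\ exists2 A, small K A & group_over D A G.

Definition is_G00 (K : Type) L (M : structure L) gT n
    (D : definable_group M gT n) (G G00 : set gT) : Prop :=
  let P H := [/\ type_definable_subgroup K D H, H `<=` G
               & small K (cosets G H)] in
  P G00 /\ (forall H, P H -> G00 `<=` H).

Definition dp_minimal (K : Type) L (M : structure L) gT n
    (D : definable_group M gT n) (G : set gT) : Prop :=
  exists B, [/\ small K B, group_over D B G &
    forall d1 d2 (J1 : orderType d1) (J2 : orderType d2) m1 m2
      (a1 : J1 -> 'I_m1 -> M) (a2 : J2 -> 'I_m2 -> M),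
      infinite_set [set: J1] -> infinite_set [set: J2] ->
      mutually_indiscernible B a1 a2 ->
      forall g, G g ->
        indiscernible (B `|` range (pt D g)) a1 \/
        indiscernible (B `|` range (pt D g)) a2].

(* The type pi(x) /\ G(x) is translated through its set of realizations; [act]
   is left or right translation. *)
Definition f_generic_wrt (K : Type) L (M : structure L) gT n
    (D : definable_group M gT n) (act : gT -> gT -> gT) (G : set gT)
    (p : set (formula L ('I_n + M))) : Prop :=
  forall M0, small K M0 -> elementary_submodel M0 -> group_over D M0 G ->
    type_definable M0 (realizations p) ->
  forall g, G g ->
    ~ forks M0 [set pt D (act g h) |
                  h in G `&` [set h | realizes id (pt D h) p]].

Definition left_f_generic (K : Type) L (M : structure L) gT n
    (D : definable_group M gT n) :=
  f_generic_wrt K D (fun g h => (g * h)%g).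

Definition right_f_generic (K : Type) L (M : structure L) gT n
    (D : definable_group M gT n) :=
  f_generic_wrt K D (fun g h => (h * g)%g).

Definition global_bi_f_generic (K : Type) L (M : structure L) gT n
    (D : definable_group M gT n) (G : set gT)
    (q : set (formula L ('I_n + M))) : Prop :=
  (forall A, small K A -> left_f_generic K D G (restriction q A)) /\
  (forall A, small K A -> right_f_generic K D G (restriction q A)).

Definition concentrated_on (K : Type) L (M : structure L) (V : Type)
    (q : set (formula L (V + M))) (X : set (V -> M)) : Prop :=
  exists A (p : set (formula L (V + M))),
    [/\ small K A, forall phi, p phi -> over A phi, X = realizations p &
      forall (N : structure L) (j : M -> N) (x : V -> N),
        elementary j -> realizes j x q -> realizes j x p].

(* [is_power D j x k y] says that y = x^k in the group of [N]-points, for [N] an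
   elementary extension of [M] through [j]. *)
Fixpoint is_power L (M N : structure L) gT n (D : definable_group M gT n)
    (j : M -> N) (x : 'I_n -> N) (k : nat) (y : 'I_n -> N) : Prop :=
  if k is k'.+1
  then exists2 z, is_power D j x k' z &
         sat (mul D) (cat_env (cat_env (cat_env z x) y) j)
  else y = j \o pt D 1%g.

Definition non_torsion_type L (M : structure L) gT n
    (D : definable_group M gT n) (q : set (formula L ('I_n + M))) : Prop :=
  forall (N : structure L) (j : M -> N) (x : 'I_n -> N),
    elementary j -> realizes j x q ->
  forall k, (0 < k)%N -> ~ is_power D j x k (j \o pt D 1%g).

(* Main.v *)
Require Import Defs.
From mathcomp Require Import all_boot all_order.
From mathcomp Require Import boolp classical_sets functions cardinality.
From mathcomp Require Import filter.

(* Write C(x) for centralizers and g^x for x^-1 g x.  Dp-minimality excludes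
   infinite grids (v_ij) in G whose rows and columns are uniformly definable:
   averages of the row and column parameters along ultrafilters generate mutually
   indiscernible sequences, both broken by one element of G.  The grid x^i y^j
   shows that for some m > 0 and all x, y in G, x^m commutes with y or x with y^m;
   in particular m-th powers commute.

   A type-definable subgroup H on which q concentrates has small index in G:
   otherwise a coheir sequence of elements in distinct cosets makes a translate of
   a definable neighborhood of H divide.  Thus if q implies that x commutes with
   e, then e centralizes G00.  If no non-torsion element of G centralizes G00,
   the elements of G that commute with x^m for x realizing q are those that commute
   with some non-torsion element; they form a type-definable group on which q
   concentrates, so that it contains G00.  In either case every small subset of G00
   is centralized by a non-torsion element z of G.

   Let g be in G00.  If infinitely many g^(x_i), with x_i in G00, were distinct
   modulo C(G00), then for w realizing q over them and z as above, the elements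
   g^(x_i) z^j would form a forbidden grid, with rows the cosets of C(w): columns
   are disjoint because g^u = g z^r with u commuting with z gives
   (g^m)^(u^m) = g^m z^(r m^2).  Hence the x in G00 with [g, x] in C(G00) form a
   subgroup of finite index in G00, which is type-definable by compactness, and so
   is G00.  By compactness [[x, y], w] = 1 holds on a definable neighborhood of
   G00, and the subgroup that it generates inside G is as required. *)

Set Implicit Arguments.
Unset Strict Implicit.
Unset Printing Implicit Defensive.

Local Open Scope classical_set_scope.
Local Open Scope card_scope.

(** * Small sets *)

Lemma card_leTP T U :
  ([set: T] #<= [set: U]) <-> exists f : T -> U, injective f.
Proof.
split=> [/card_leP[f]|[f f_inj]].
  exists (fun t => set_val (f (SigSub (mem_set (I : [set: T] t))))) => t u.
  move=> /val_inj/(@inj _ _ _ f); rewrite !inE => /(_ I I).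
  by move=> /(congr1 set_val).
have /injfunPex[g] : exists2 f : T -> U, set_fun [set: T] [set: U] f &
    set_inj [set: T] f by exists f => // t u _ _; exact: f_inj.
exact: inj_card_le.
Qed.

(** Zorn's lemma applies to the graphs of partial injections. A maximal graph is total on one side,
    since otherwise an unmatched pair could be added. *)
Lemma card_le_total T U : ([set: T] #<= [set: U]) \/ ([set: U] #<= [set: T]).
Proof.
pose P (R : set (T * U)) := (forall x y y', R (x, y) -> R (x, y') -> y = y') /\
  (forall x x' y, R (x, y) -> R (x', y) -> x = x').
have [|R [[Rf Ri] Rmax]] := @Zorn_bigcup _ P.
  move=> F FP Ftot; split=> [x y y' [A FA Axy] [B FB Bxy]|x x' y [A FA Axy] [B FB Bxy]].
    have [AB|BA] := Ftot A B FA FB; first exact: (FP B FB).1 (AB _ Axy) Bxy.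
    exact: (FP A FA).1 Axy (BA _ Bxy).
  have [AB|BA] := Ftot A B FA FB; first exact: (FP B FB).2 (AB _ Axy) Bxy.
  exact: (FP A FA).2 Axy (BA _ Bxy).
have [dom|/existsNP[x0 Rx0]] := EM (forall x, exists y, R (x, y)).
  left; apply/card_leTP; have [f fR] := choice dom.
  by exists f => x x' fx; apply: Ri (fR x) _; rewrite fx.
have [cod|/existsNP[y0 Ry0]] := EM (forall y, exists x, R (x, y)).
  right; apply/card_leTP; have [f fR] := choice cod.
  by exists f => y y' fy; apply: Rf (fR y) _; rewrite fy.
exfalso; apply: (Rmax (R `|` [set (x0, y0)])).
  split; first by move=> ? ?; left.
  by move=> /(_ (x0, y0))/(_ (or_intror erefl)) Rxy; apply: Rx0; exists y0.
split=> [x y y'|x x' y] [Rxy|[-> ->]] [Rxy'|[]] //.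
- exact: Rf Rxy Rxy'.
- by move=> xE yE; case: Rx0; exists y; rewrite -xE.
- by case: Rx0; exists y'.
- exact: Ri Rxy Rxy'.
- by move=> xE yE; case: Ry0; exists x; rewrite -yE.
- by case: Ry0; exists x'.
Qed.

Section Small.
Variable K : Type.

Lemma small_le T U (A : set T) (B : set U) :
  A #<= B -> small K B -> small K A.
Proof.
move=> AB [BK KB]; split; first exact: card_le_trans AB BK.
by move=> KA; apply: KB; exact: card_le_trans KA AB.
Qed.

Lemma small_sub T (A B : set T) : A `<=` B -> small K B -> small K A.
Proof. by move=> /subset_card_le; exact: small_le. Qed.

Lemma small_image T U (f : T -> U) (A : set T) :
  small K A -> small K (f @` A).
Proof. exact/small_le/card_image_le. Qed.

Lemma smallT_inj T U (f : T -> U) :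
  injective f -> small K [set: U] -> small K [set: T].
Proof. by move=> f_inj; apply: small_le; apply/card_leTP; exists f. Qed.

Lemma smallT_set T (A : set T) : small K A -> small K [set: A].
Proof. by apply: small_le; have /card_eqPle[] := card_setT A. Qed.

Hypothesis K_limit : strong_limit K.

(** [strong_limit] speaks of subsets of [K] only. An injection of [T] into [K] carries the subsets
    of [T] to subsets of its range, which is small. *)
Lemma smallT_pow T : small K [set: T] -> small K [set: set T].
Proof.
move=> Tsmall; have [/card_leTP[f f_inj] _] := Tsmall.
apply: (@small_le _ _ _ [set B : set K | B `<=` range f]).
  apply: (@card_le_trans _ _ _ [set: [set B : set K | B `<=` range f]]).
    apply/card_leTP.
    have sub (X : set T) : (f @` X) \in [set B : set K | B `<=` range f].
      by rewrite inE => _ [x _ <-]; exists x.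
    exists (fun X => SigSub (sub X)) => X Y /(congr1 val)/= XY.
    apply/seteqP; split=> x Xx.
      have : (f @` X) (f x) by exists x.
      by rewrite XY => -[y Yy /f_inj <-].
    have : (f @` Y) (f x) by exists x.
    by rewrite -XY => -[y Yy /f_inj <-].
  by have /card_eqPle[] := card_setT [set B : set K | B `<=` range f].
exact/K_limit/small_image.
Qed.

Hypothesis nat_small : small K [set: nat].

(** Cardinal arithmetic is avoided: when one summand injects into the other, the sum embeds in a
    power set, by complements of singletons on one side and singletons on the other. *)
Lemma smallT_sum T U :
  small K [set: T] -> small K [set: U] -> small K [set: T + U].
Proof.
wlog : T U / [set: T] #<= [set: U] => [wlg|].
  have [TU|UT] := card_le_total T U; first exact: wlg.
  move=> Ts Us; apply: (@smallT_inj _ (U + T)%type (fun x =>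
    match x with inl t => inr t | inr u => inl u end)); last exact: wlg.
  by move=> [?|?] [?|?] // [->].
move=> /card_leTP[f f_inj] _ Us.
(* [nat] keeps the larger summand from having fewer than three elements, so that
   singletons and complements of singletons are distinct. *)
have {Us} natUs : exists V (g : U -> V) (h : nat -> V),
    [/\ injective g, injective h & small K [set: V]].
  have [/card_leTP[g g_inj]|/card_leTP[h h_inj]] := card_le_total U nat.
    by exists nat, g, id; split.
  by exists U, id, h; split.
have [V [g [h [g_inj h_inj Vs]]]] := natUs.
apply: (@smallT_inj _ (set V) (fun x => match x with
  | inl t => ~` [set g (f t)] | inr u => [set g u] end)); last exact: smallT_pow.
have neq (a b : V) : ~` [set a] <> [set b].
  move=> ab; have hb i : h i = a \/ h i = b.
    have [->|ha] := EM (h i = a); [by left|right].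
    by have : (~` [set a]) (h i) by []; rewrite ab.
  have h01 : h 0 <> h 1 by move/h_inj.
  have h02 : h 0 <> h 2 by move/h_inj.
  have h12 : h 1 <> h 2 by move/h_inj.
  by case: (hb 0); case: (hb 1); case: (hb 2); congruence.
move=> [t|u] [t'|u'].
- move=> /setC_inj/seteqP[/(_ (g (f t)) erefl) /= + _].
  by move=> /g_inj/f_inj ->.
- by move=> /neq.
- by move=> /esym/neq.
- by move=> /seteqP[/(_ (g u) erefl) /= + _] => /g_inj ->.
Qed.

(** A pair is coded by a subset of the sum; below, a sequence is coded by its graph in [nat * T]. *)
Lemma smallT_prod T U :
  small K [set: T] -> small K [set: U] -> small K [set: T * U].
Proof.
move=> Ts Us; apply: (@smallT_inj _ (set (T + U)) (fun x =>
  [set inl x.1; inr x.2])); last exact/smallT_pow/smallT_sum.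
move=> [t u] [t' u'] /seteqP[tu _].
by have [[->]|//] := tu (inl t) (or_introl erefl);
  have [//|[->]] := tu (inr u) (or_intror erefl).
Qed.

Lemma smallT_seq T : small K [set: T] -> small K [set: seq T].
Proof.
move=> Ts; apply: (@smallT_inj _ (set (nat * T)) (fun s =>
  [set ix | onth s ix.1 = Some ix.2])); last exact/smallT_pow/smallT_prod.
elim=> [|x s IHs] [|y t] //.
- by move=> /seteqP[_ /(_ (0, y)) /= /(_ erefl)].
- by move=> /seteqP[/(_ (0, x)) /= /(_ erefl)].
move=> xyst; congr (_ :: _).
  by move/seteqP: xyst => [/(_ (0, x)) /= /(_ erefl) [->]].
apply: IHs; apply/seteqP; split=> -[i z] /= iz.
  by move/seteqP: xyst => [/(_ (i.+1, z)) /= /(_ iz)].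
by move/seteqP: xyst => [_ /(_ (i.+1, z)) /= /(_ iz)].
Qed.

Lemma smallT_tree T : small K [set: T] -> small K [set: GenTree.tree T].
Proof.
move=> Ts; apply: (@smallT_inj _ (seq (nat + T)) (@GenTree.encode T)).
  exact: pcan_inj (@GenTree.codeK T).
exact/smallT_seq/smallT_sum.
Qed.

Lemma small_setU T (A B : set T) : small K A -> small K B -> small K (A `|` B).
Proof.
move=> As Bs; pose f (x : (A + B)%type) : T :=
  match x with inl a => val a | inr b => val b end.
apply: (@small_sub _ _ (range f)); last first.
  by apply: small_image; apply: smallT_sum; exact: smallT_set.
move=> x [Ax|Bx]; first by exists (inl (SigSub (mem_set Ax))).
by exists (inr (SigSub (mem_set Bx))).
Qed.

Lemma small_countable T (J : countType) (f : J -> T) : small K (range f).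
Proof.
apply: small_image; apply: smallT_inj nat_small.
exact: pcan_inj (@pickleK J).
Qed.

End Small.

(** * Renaming and free variables *)

Section Syntax.
Variable L : language.

Definition And V (phi psi : formula L V) := Neg (Imp phi (Neg psi)).
Definition Ex V (phi : formula L (option V)) := Neg (All (Neg phi)).

Fixpoint term_rename V W (f : V -> W) (t : term L V) : term L W :=
  match t with
  | Var v => Var L (f v)
  | App s ts => App (fun i => term_rename f (ts i))
  end.

Fixpoint rename V W (f : V -> W) (phi : formula L V) : formula L W :=
  match phi with
  | Bot => Bot
  | Eq t u => Eq (term_rename f t) (term_rename f u)
  | Rel r ts => Rel (fun i => term_rename f (ts i))
  | Imp phi psi => Imp (rename f phi) (rename f psi)
  | All phi => All (rename (omap f) phi)
  end.

Lemma term_fv_rename V W (f : V -> W) (t : term L V) w :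
  term_fv (term_rename f t) w -> exists2 v, term_fv t v & f v = w.
Proof.
elim: t => [v ->|s ts IH [i /IH[v tv vw]]]; first by exists v.
by exists v => //; exists i.
Qed.

Lemma fv_rename V W (f : V -> W) (phi : formula L V) w :
  fv (rename f phi) w -> exists2 v, fv phi v & f v = w.
Proof.
move: W f w; induction phi as [V|V t u|V r ts|V phi IH1 psi IH2|V phi IH] => W f w /=.
- by [].
- by case=> tw; have [v tv vw] := term_fv_rename tw; exists v => //; [left|right].
- by move=> [i tw]; have [v tv vw] := term_fv_rename tw; exists v => //; exists i.
- by case=> tw; [have [v tv vw] := IH1 _ _ _ tw|have [v tv vw] := IH2 _ _ _ tw];
    exists v => //; [left|right].
- by move=> tw; have [[v|] tv //= [vw]] := IH _ _ _ tw; exists v.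
Qed.

Lemma term_fv_finite V (t : term L V) : finite_set (term_fv t).
Proof.
elim: t => [v|s ts IH] /=; first exact: finite_set1.
rewrite (_ : mkset _ = \bigcup_i term_fv (ts i)).
  by apply: bigcup_finite => // i _; exact: IH.
by apply/seteqP; split=> v [i]; [exists i|move=> _ ?; exists i].
Qed.

Lemma fv_finite V (phi : formula L V) : finite_set (fv phi).
Proof.
induction phi as [V|V t u|V r ts|V phi IH1 psi IH2|V phi IH] => /=.
- exact: finite_set0.
- by rewrite finite_setU; split; exact: term_fv_finite.
- rewrite (_ : mkset _ = \bigcup_i term_fv (ts i)).
    by apply: bigcup_finite => // i _; exact: term_fv_finite.
  by apply/seteqP; split=> v [i]; [exists i|move=> _ ?; exists i].
- by rewrite finite_setU.
- by apply: finite_preimage IH => v w _ _ [].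
Qed.

Lemma fv_Neg V (phi : formula L V) v : fv (Neg phi) v <-> fv phi v.
Proof. by split=> [[]|pv] //; left. Qed.

Lemma fv_And V (phi psi : formula L V) v :
  fv (And phi psi) v <-> fv phi v \/ fv psi v.
Proof.
split=> [/fv_Neg[pv|/fv_Neg pv]|[pv|pv]]; [by left|by right| |].
  by apply/fv_Neg; left.
by apply/fv_Neg; right; apply/fv_Neg.
Qed.

Lemma fv_Ex V (phi : formula L (option V)) v :
  fv (Ex phi) v <-> fv phi (Some v).
Proof.
split=> [/fv_Neg/= pv|pv]; first by apply/fv_Neg.
by apply/fv_Neg; change (fv (Neg phi) (Some v)); apply/fv_Neg.
Qed.

Section Eval.
Variable M : structure L.

Lemma eval_rename V W (f : V -> W) (t : term L V) (e : W -> M) :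
  eval e (term_rename f t) = eval (e \o f) t.
Proof. by elim: t => //= s ts IH; congr fun_interp; apply/funext. Qed.

Lemma sat_rename V W (f : V -> W) (phi : formula L V) (e : W -> M) :
  sat (rename f phi) e <-> sat phi (e \o f).
Proof.
move: W f e; induction phi as [V|V t u|V r ts|V phi IH1 psi IH2|V phi IH] => W f e //=.
- by rewrite !eval_rename.
- by rewrite (_ : (fun i => _) = fun i => eval (e \o f) (ts i)) //;
    apply/funext => i; rewrite eval_rename.
- by split=> imp /IH1 /imp /IH2.
- split=> all x; have := all x; rewrite IH.
    by congr (sat phi _); apply/funext; case.
  by congr (sat phi _); apply/funext; case.
Qed.

Lemma eval_eq_fv V (t : term L V) (e e' : V -> M) :
  (forall v, term_fv t v -> e v = e' v) -> eval e t = eval e' t.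
Proof.
elim: t => [v ee'|s ts IH ee'] /=; first exact: ee'.
by congr fun_interp; apply/funext => i; apply: IH => v tv; apply: ee'; exists i.
Qed.

Lemma sat_eq_fv V (phi : formula L V) (e e' : V -> M) :
  (forall v, fv phi v -> e v = e' v) -> sat phi e <-> sat phi e'.
Proof.
move: e e'; induction phi as [V|V t u|V r ts|V phi IH1 psi IH2|V phi IH] => e e' ee' //=.
- by rewrite (@eval_eq_fv _ t e e') ?(@eval_eq_fv _ u e e')// => v tv;
    apply: ee'; [right|left].
- rewrite (_ : (fun i => _) = fun i => eval e' (ts i)) //.
  by apply/funext => i; apply: eval_eq_fv => v tv; apply: ee'; exists i.
- have {}IH1 := IH1 e e' (fun v pv => ee' v (or_introl pv)).
  have {}IH2 := IH2 e e' (fun v pv => ee' v (or_intror pv)).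
  by split=> imp /IH1 /imp /IH2.
- by split=> all x; have := all x; apply IH => -[v|] //= /ee' ->.
Qed.

Lemma sat_Neg V (phi : formula L V) (e : V -> M) :
  sat (Neg phi) e <-> ~ sat phi e.
Proof. by []. Qed.

Lemma sat_And V (phi psi : formula L V) (e : V -> M) :
  sat (And phi psi) e <-> sat phi e /\ sat psi e.
Proof.
split=> [nimp|[pe qe] /(_ pe)] //=.
by split; apply: contrapT => np; apply: nimp => // pe; exfalso.
Qed.

Lemma sat_Ex V (phi : formula L (option V)) (e : V -> M) :
  sat (Ex phi) e <->
  exists x, sat phi (fun v => if v is Some w then e w else x).
Proof.
split=> [nall|[x px] /(_ x)] //=.
by apply: contrapT => /forallNP np; apply: nall => x /np.
Qed.

End Eval.

(** The first variable of the block becomes the bound variable [None], so that [ExN] can quantify a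
    block one variable at a time. *)
Definition block_swap V k (v : V + 'I_k.+1) : option (V + 'I_k) :=
  match v with
  | inl v => Some (inl v)
  | inr i => omap inr (unlift ord0 i)
  end.

Definition block0 V W (f : V -> W) (v : V + 'I_0) : W :=
  match v with
  | inl v => f v
  | inr i => False_rect W (notF (ltn_ord i))
  end.

Fixpoint ExN V k : formula L (V + 'I_k) -> formula L V :=
  match k with
  | 0 => rename (@block0 V V id)
  | k'.+1 => fun phi => ExN (Ex (rename (@block_swap V k') phi))
  end.

Lemma fv_ExN V k (phi : formula L (V + 'I_k)) v :
  fv (ExN phi) v -> fv phi (inl v).
Proof.
elim: k phi => [|k IH] phi /=.
  by move=> pv; have [[w|[]] pw // <-] := fv_rename pv.
move=> pv; have [[w|i] pw //=] := fv_rename (proj1 (fv_Ex _ _) (IH _ pv)).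
  by case=> <-.
by case: unliftP => // j _.
Qed.

Lemma sat_ExN (M : structure L) V k (phi : formula L (V + 'I_k)) (e : V -> M) :
  sat (ExN phi) e <-> exists y, sat phi (cat_env e y).
Proof.
elim: k phi => [|k IH] phi /=.
  rewrite sat_rename; split=> [pe|[y pe]].
    exists (fun i : 'I_0 => False_rect M (notF (ltn_ord i))).
    by move: pe; congr (sat phi _); apply/funext => -[|[]].
  by move: pe; congr (sat phi _); apply/funext => -[|[]].
rewrite IH; split=> [[y /sat_Ex[x]]|[y]].
  rewrite sat_rename => pe.
  exists (fun i => if unlift ord0 i is Some j then y j else x).
  move: pe; congr (sat phi _); apply/funext => -[//|i] /=.
  by case: unliftP.
move=> pe; exists (fun j => y (lift ord0 j)); apply/sat_Ex; exists (y ord0).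
rewrite sat_rename; move: pe; congr (sat phi _); apply/funext => -[//|i] /=.
by case: unliftP => [j|] ->.
Qed.

End Syntax.

(** * Definable sets and saturation *)

Lemma finite_enum T (X : set T) (a0 : T) : finite_set X ->
  exists k (b : 'I_k -> T) (r : T -> 'I_k),
    (forall i, X (b i) \/ b i = a0) /\ (forall a, X a -> b (r a) = a).
Proof.
elim/Peq: T => T in X a0 * => /finite_seqP[s ->].
(* The extra index [size s], sent to [a0], keeps the ordinal type inhabited when [X] is empty, so
   that [r] is total. *)
exists (size s).+1, (nth a0 s \o val), (fun a => inord (index a s)); split=> /=.
  move=> i; have [i_lt|i_ge] := ltnP i (size s); last first.
    by right; rewrite nth_default.
  by left; exact: mem_nth.
by move=> a sa; rewrite inordK ?ltnS ?index_size// nth_index.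
Qed.

Section Definable.
Variables (L : language) (M : structure L).
Implicit Types (A B : set M).

Lemma definable_sub V A B (X : set (V -> M)) :
  A `<=` B -> definable A X -> definable B X.
Proof. by move=> AB [phi pA ->]; exists phi => // a /pA /AB. Qed.

Lemma definableT V A : definable A [set: V -> M].
Proof.
exists (Imp Bot Bot) => [a|]; first by case.
by apply/seteqP; split=> // x _ /=.
Qed.

Lemma definableC V A (X : set (V -> M)) : definable A X -> definable A (~` X).
Proof.
by move=> [phi pA ->]; exists (Neg phi) => [a pa|//]; exact/pA/(fv_Neg _ _).1.
Qed.

Lemma definableI V A (X Y : set (V -> M)) :
  definable A X -> definable A Y -> definable A (X `&` Y).
Proof.
move=> [phi pA ->] [psi qA ->]; exists (And phi psi).
  by move=> a pa; have [/pA|/qA] := (fv_And _ _ _).1 pa.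
by apply/seteqP; split=> x /= px; exact/sat_And.
Qed.

Lemma definable_iff V A (X Y : set (V -> M)) :
  (forall x, X x <-> Y x) -> definable A X -> definable A Y.
Proof. by move=> XY; rewrite (_ : Y = X) //; apply/seteqP; split=> x /XY. Qed.

(* [f v] is either a new variable or a parameter. *)
Lemma definable_subst V W A (f : V -> W + M) (X : set (V -> M)) :
  (forall v a, f v = inr a -> A a) -> definable A X ->
  definable A [set e : W -> M | X (cat_env e id \o f)].
Proof.
move=> fA [phi pA ->]; exists (rename (fun u => match u with
  inl v => f v | inr a => inr a end) phi).
  move=> a pa; have [[v|a'] pv /=] := fv_rename pa; first exact: fA.
  by case=> <-; exact: pA.
apply/seteqP; split=> e /=; rewrite sat_rename; congr (sat phi _).
  by apply/funext => -[].
by apply/funext => -[].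
Qed.

Lemma definable_reindex V W A (f : V -> W) (X : set (V -> M)) :
  definable A X -> definable A [set e : W -> M | X (e \o f)].
Proof. by apply: (definable_subst (f := fun v => inl (f v))). Qed.

Lemma definable_ex V k A (X : set (V + 'I_k -> M)) :
  definable A X -> definable A [set e | exists y, X (cat_env e y)].
Proof.
move=> [phi pA ->]; pose f (u : (V + 'I_k) + M) : (V + M) + 'I_k :=
  match u with
  | inl (inl v) => inl (inl v) | inl (inr i) => inr i | inr a => inl (inr a)
  end.
exists (ExN (rename f phi)).
  move=> a pa; have [[[v|i]|a'] pv //=] := fv_rename (fv_ExN pa).
  by case=> <-; exact: pA.
have E (e : V -> M) y : cat_env (cat_env e id) y \o f = cat_env (cat_env e y) id.
  by apply/funext => -[[]|].
apply/seteqP; split=> e /=; rewrite sat_ExN.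
  by move=> [y py]; exists y; rewrite sat_rename E.
by move=> [y py]; exists y; move: py; rewrite sat_rename E.
Qed.

(** Gathers the parameters of a formula into one finite tuple, the form in which [divides] takes
    them. *)
Lemma definable_params V A (X : set (V -> M)) a0 : A a0 -> definable A X ->
  exists k (b : 'I_k -> M) (psi : formula L (V + 'I_k)),
    (forall i, A (b i)) /\ X = [set x | sat psi (cat_env x b)].
Proof.
move=> Aa0 [phi pA ->].
have [|k [b [r [bA br]]]] := @finite_enum _ [set a | fv phi (inr a)] a0.
  by apply: finite_preimage (fv_finite phi) => ? ? _ _ [].
pose f (u : V + M) : V + 'I_k := match u with inl v => inl v | inr a => inr (r a) end.
exists k, b, (rename f phi); split; first by move=> i; have [/pA|->] := bA i.
apply/seteqP; split=> x /=; rewrite sat_rename; apply sat_eq_fv => -[//|a] pa /=.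
  by rewrite br.
by rewrite br.
Qed.

Lemma same_typeP V A (x y : V -> M) :
  (forall X, definable A X -> X x -> X y) -> same_type A x y.
Proof.
move=> xy phi pA; split; first by apply: (xy [set z | _]); exists phi.
apply: contraPP; apply: (xy [set z | ~ sat phi (cat_env z id)]).
by apply: definableC; exists phi.
Qed.

Lemma same_type_def V A (x y : V -> M) (X : set (V -> M)) :
  same_type A x y -> definable A X -> X x <-> X y.
Proof. by move=> xy [phi pA ->]; exact: xy. Qed.

Lemma same_type_sym V A (x y : V -> M) : same_type A x y -> same_type A y x.
Proof. by move=> xy phi pA; rewrite xy. Qed.

Lemma same_type_trans V A (y x z : V -> M) :
  same_type A x y -> same_type A y z -> same_type A x z.
Proof. by move=> xy yz phi pA; rewrite xy// yz. Qed.

Lemma same_type_reindex V W A (f : V -> W) (x y : W -> M) :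
  same_type A x y -> same_type A (x \o f) (y \o f).
Proof.
move=> xy; apply: same_typeP => X Xd Xx.
exact: (same_type_def xy (definable_reindex f Xd)).1.
Qed.

Lemma same_type_sub V A B (x y : V -> M) :
  A `<=` B -> same_type B x y -> same_type A x y.
Proof. by move=> AB xy phi pA; apply: xy => a /pA/AB. Qed.

Variable K : Type.
Hypothesis sat_M : saturated K M.

Lemma saturated_fip (V : finType) A (P : set (set (V -> M))) :
  small K A -> (forall X, P X -> definable A X) ->
  (forall F, finite_set F -> F `<=` P -> exists x, forall X, F X -> X x) ->
  exists x, forall X, P X -> X x.
Proof.
move=> As Pd fip.
(* Saturation is about tuples indexed by ordinals, so [V] is enumerated. Taking every formula over
   [A] that defines a member of [P] avoids choosing one for each. *)
pose p : set (formula L ('I_#|V| + M)) := [set phi | Defs.over A phi /\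
  P [set x : V -> M | sat phi (cat_env (x \o enum_val) id)]].
have := sat_M (p := p) As.
case=> [phi []//||x xp].
  move=> p0 p0f p0p.
  have [||x xF] := fip ((fun phi => [set x : V -> M | sat phi
      (cat_env (x \o enum_val) id)]) @` p0).
  - exact: finite_image.
  - by move=> _ [phi /p0p[_ Pphi] <-].
  by exists (x \o enum_val) => phi p0phi; apply: (xF [set x | _]); exists phi.
exists (x \o enum_rank) => X PX; have [phi pA XE] := Pd X PX.
have xE : (x \o enum_rank) \o enum_val = x.
  by apply/funext => i /=; rewrite enum_valK.
have E y : cat_env (y : 'I_#|V| -> M) id \o (fun u => match u with
  inl v => inl (enum_rank v) | inr a => inr a end) =
  cat_env (y \o enum_rank) id by apply/funext => -[].
suff : sat (rename (fun u => match u with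
    inl v => inl (enum_rank v) | inr a => inr a end) phi) (cat_env x id).
  by rewrite sat_rename E XE.
apply: xp; split=> [a pa|].
  by have [[v|a'] pv //= [<-]] := fv_rename pa; exact: pA.
move: PX; rewrite XE; congr P; apply/seteqP; split=> y /=;
rewrite sat_rename E (_ : (y \o enum_val) \o enum_rank = y) //;
by apply/funext => v /=; rewrite enum_rankK.
Qed.

Lemma saturated_directed (V : finType) A (P : set (set (V -> M))) :
  small K A -> (forall X, P X -> definable A X) ->
  P !=set0 -> (forall X Y, P X -> P Y -> exists2 Z, P Z & Z `<=` X `&` Y) ->
  (forall X, P X -> X !=set0) ->
  exists x, forall X, P X -> X x.
Proof.
move=> As Pd [X0 PX0] Pdir Pne; apply: (saturated_fip As Pd) => F Ff FP.
suff [Z PZ ZF] : exists2 Z, P Z & forall X, F X -> Z `<=` X.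
  by have [z Zz] := Pne Z PZ; exists z => X /ZF; apply.
have /finite_seqP[s sE] := Ff; rewrite {F Ff}sE in FP *.
elim: s FP => [|X s IHs] FP; first by exists X0.
have [|Z PZ ZF] := IHs.
  by move=> Y /= Ys; apply: FP; rewrite /= inE Ys orbT.
have [W PW WZ] := Pdir X Z (FP X (mem_head _ _)) PZ.
exists W => // Y /=; rewrite inE => /orP[/eqP ->|/ZF ZY] w /WZ[] //.
by move=> _ /ZY.
Qed.

End Definable.

(** * Averages along ultrafilters and Morley sequences *)

Lemma finite_chain T (X : set T) (A : nat -> set T) :
  (forall k l, (k <= l)%N -> A k `<=` A l) ->
  finite_set X -> (forall x, X x -> exists k, A k x) ->
  exists k, X `<=` A k.
Proof.
elim/Peq: T => T in X A * => Ainc /finite_seqP[s ->] {X}.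
elim: s => [|x s IHs] sA; first by exists 0.
have [y ys|k sk] := IHs; first by apply: sA; rewrite /= inE ys orbT.
have [l xl] := sA x (mem_head _ _).
exists (maxn k l) => y /=; rewrite inE => /orP[/eqP->|/sk].
  exact: Ainc (leq_maxr _ _) _ xl.
exact: Ainc (leq_maxl _ _) _.
Qed.

Section Average.
Variables (L : language) (M : structure L) (K : Type).
Hypotheses (sat_M : saturated K M) (K_limit : strong_limit K).
Hypothesis nat_small : small K [set: nat].
Implicit Types (A E : set M).

Lemma definable_split V U A (b : U -> M) (X : set (V -> M)) :
  definable (A `|` range b) X ->
  exists2 Y : set (V + U -> M), definable A Y & X = [set x | Y (cat_env x b)].
Proof.
move=> [phi pA ->].
(* A parameter in [A] stays a parameter; one that lies only in [range b] becomes a variable of the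
   second block. *)
have [r rP] : {r : M -> (V + U) + M & forall c, (A `|` range b) c ->
    (forall a, r c = inr a -> A a) /\ forall x, cat_env (cat_env x b) id (r c) = c}.
  apply: (@choice _ _ (fun c u => (A `|` range b) c -> (forall a, u = inr a -> A a) /\
    forall x, cat_env (cat_env x b) id u = c)) => c.
  have [Ac|nAc] := EM (A c).
    by exists (inr c) => _; split => // a [<-].
  have [[u _ uc]|nb] := EM (range b c); first by exists (inl (inr u)).
  by exists (inr c) => -[].
exists [set z | sat (rename (fun u => match u with inl v => inl (inl v)
    | inr c => r c end) phi) (cat_env z id)].
  eexists; last reflexivity.
  move=> a pa; have [[v|c] pc //= rc] := fv_rename pa.
  exact: (rP c (pA c pc)).1.
apply/seteqP; split=> x /=; rewrite sat_rename; apply sat_eq_fv => -[//|c] /= pc.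
  by rewrite (rP c (pA c pc)).2.
by rewrite (rP c (pA c pc)).2.
Qed.

(* [a] realizes over [E] the average of the tuples along [F]. *)
Definition avg (V : Type) E (F : set_system (V -> M)) (a : V -> M) :=
  forall X, definable E X -> F X -> X a.

Lemma avg_sub V E E' (F : set_system (V -> M)) a :
  E `<=` E' -> avg E' F a -> avg E F a.
Proof. by move=> EE' aF X Xd; apply: aF; exact: definable_sub EE' Xd. Qed.

Lemma avg_ex (V : finType) E (F : set_system (V -> M)) :
  ProperFilter F -> small K E -> exists a, avg E F a.
Proof.
move=> FF Es.
have [||||a aP] := @saturated_directed _ _ _ sat_M V E
   [set X | definable E X /\ F X] Es; last by exists a => X Xd FX; exact: aP.
- by move=> X [].
- by exists setT; split; [exact: definableT|exact: filterT].
- move=> X Y [Xd FX] [Yd FY]; exists (X `&` Y) => //; split.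
    exact: definableI.
  exact: filterI.
- by move=> X [_ FX]; exact: filter_ex FX.
Qed.

Lemma avg_iff V E (F : set_system (V -> M)) a X :
  UltraFilter F -> avg E F a -> definable E X -> X a <-> F X.
Proof.
move=> FU aF Xd; split=> [Xa|FX]; last exact: aF.
by have [//|/(aF _ (definableC Xd))] := in_ultra_setVsetC X FU.
Qed.

(** For [X] over [E], whether [X] holds of [x] and [a] is decided by whether the fiber of [X] at [x]
    belongs to [F]. As [F] lives on tuples from [E], and [x] and [y] have the same type over [E],
    the fibers at [x] and at [y] agree on such tuples. *)
Lemma avg_same_type V W E (F : set_system (V -> M)) (x y : W -> M) a b :
  UltraFilter F -> F [set c | forall v, E (c v)] -> same_type E x y ->
  avg (E `|` range x) F a -> avg (E `|` range y) F b ->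
  same_type E (cat_env x a) (cat_env y b).
Proof.
move=> FU FE xy aF bF; apply: same_typeP => X Xd.
have section_def z : definable (E `|` range z) [set c : V -> M | X (cat_env (z : W -> M) c)].
  have := @definable_subst _ _ (W + V) V (E `|` range z)
    (fun u => match u with inl w => inr (z w) | inr v => inl v end) X.
  move=> /(_ _ (definable_sub (@subsetUl _ _ _) Xd)) zX.
  apply: (definable_iff _ (zX _)).
    by move=> e /=; rewrite (_ : _ \o _ = cat_env z e) //; apply/funext => -[].
  by move=> [w|//] c [<-]; right; exists w.
move=> /(avg_iff FU aF (section_def x)) FX.
apply/(avg_iff FU bF (section_def y)).
apply: filterS (filterI FX FE) => c /= [Xc Ec]; move: Xc.
have section_def' : definable E [set z : W -> M | X (cat_env z c)].
  have := @definable_subst _ _ (W + V) W E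
    (fun u => match u with inl w => inl w | inr v => inr (c v) end) X.
  move=> /(_ _ Xd) zX; apply: (definable_iff _ (zX _)).
    by move=> e /=; rewrite (_ : _ \o _ = cat_env e c) //; apply/funext => -[].
  by move=> [//|w] d [<-].
exact: (same_type_def xy section_def').1.
Qed.

Definition initial V (a : nat -> V -> M) k : set M :=
  [set c | exists j v, (j < k)%N /\ a j v = c].

Definition morley V E (F : set_system (V -> M)) (a : nat -> V -> M) :=
  forall k, avg (E `|` initial a k) F (a k).

Lemma small_entries (V : finType) (a : nat -> V -> M) : small K (entries a).
Proof.
apply: small_sub (small_countable nat_small (fun iv : nat * V => a iv.1 iv.2)).
by move=> c [i [v <-]]; exists (i, v).
Qed.

Lemma prefix_entries V (a : nat -> V -> M) k : initial a k `<=` entries a.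
Proof. by move=> c [j [v [_ <-]]]; exists j, v. Qed.

Lemma morley_ex (V : finType) E (F : set_system (V -> M)) :
  ProperFilter F -> small K E -> exists a, morley E F a.
Proof.
move=> FF Es.
have [c cP] : {c : nat * (nat -> V -> M) -> V -> M &
    forall ks, avg (E `|` initial ks.2 ks.1) F (c ks)}.
  apply: (@choice _ _ (fun ks => avg (E `|` initial ks.2 ks.1) F)) => -[k s].
  apply: avg_ex; apply: small_setU => //.
  exact: small_sub (@prefix_entries _ _ _) (small_entries s).
have [d] := carrier_inhabited M.
(* [pre k] holds the first [k] terms and is constantly [d] beyond them; term [k] is the choice [c]
   made for this initial part. *)
pose pre := fix pre k : nat -> V -> M := if k is k'.+1
  then fun j => if (j < k')%N then pre k' j else c (k', pre k') else fun _ _ => d.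
have preE k j : (j < k)%N -> pre k j = c (j, pre j).
  elim: k => // k IHk; rewrite ltnS leq_eqVlt => /orP[/eqP ->|jk] /=.
    by rewrite ltnn.
  by rewrite jk IHk.
exists (fun k => c (k, pre k)) => k.
rewrite (_ : initial _ k = initial (pre k) k); first exact: cP (k, pre k).
by apply/seteqP; split=> x [j [v [jk <-]]]; exists j, v; rewrite preE.
Qed.

Section Indiscernible.
Variables (V : finType) (E : set M) (F : set_system (V -> M)).
Hypotheses (FU : UltraFilter F) (FE : F [set c | forall v, E (c v)]).

(** By induction on the length: the last term is split off, and it is an average over the earlier
    ones, so that [avg_same_type] applies. *)
Lemma morley_indiscernible a : morley E F a -> indiscernible E a.
Proof.
move=> aM; elim=> [|k IHk] s t s_inc t_inc.
  by rewrite (_ : (fun _ => _) = (fun iv => a (t iv.1) iv.2))//; apply/funext => -[[]].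
pose f (iv : 'I_k.+1 * V) : 'I_k * V + V :=
  if unlift ord_max iv.1 is Some j then inl (j, iv.2) else inr iv.2.
pose sub (r : 'I_k.+1 -> nat) (iv : 'I_k * V) := a (r (lift ord_max iv.1)) iv.2.
have fE (r : 'I_k.+1 -> nat) : (fun iv : 'I_k.+1 * V => a (r iv.1) iv.2) =
    cat_env (sub r) (a (r ord_max)) \o f.
  by apply/funext => -[i v]; rewrite /f /sub /=; case: unliftP => [j|] ->.
rewrite !fE; apply: same_type_reindex.
have sub_prefix (r : 'I_k.+1 -> nat) :
    (forall i i' : 'I_k.+1, (i < i')%N -> (r i < r i')%O) ->
    avg (E `|` range (sub r)) F (a (r ord_max)).
  move=> r_inc; apply: avg_sub (aM (r ord_max)); apply: setUS => _ [[i v] _ <-].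
  exists (r (lift ord_max i)), v; split => //.
  have := r_inc (lift ord_max i) ord_max; rewrite ltEnat; apply.
  by rewrite lift_max /=.
apply: avg_same_type (sub_prefix s s_inc) (sub_prefix t t_inc) => //.
by apply: (IHk (s \o lift ord_max) (t \o lift ord_max)) => i i' ii';
  [apply: s_inc|apply: t_inc]; rewrite !lift_max.
Qed.

(** A Morley sequence over a set containing [x] and [y] cannot tell them apart. Initial segments are
    treated by induction with [avg_same_type], and a formula involves only finitely many terms. *)
Lemma morley_same_type W (x y : W -> M) (B : set M) a :
  E `|` range x `<=` B -> E `|` range y `<=` B -> morley B F a ->
  same_type E x y ->
  same_type E (cat_env x (fun iv : nat * V => a iv.1 iv.2))
              (cat_env y (fun iv : nat * V => a iv.1 iv.2)).
Proof.
move=> xB yB aM xy.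
pose pre k (iv : 'I_k * V) := a iv.1 iv.2.
have pre_xy k : same_type E (cat_env x (@pre k)) (cat_env y (@pre k)).
  elim: k => [|k IHk].
    pose f (u : W + 'I_0 * V) : W := match u with inl w => w
      | inr iv => False_rect W (notF (ltn_ord iv.1)) end.
    have fE (z : W -> M) : cat_env z (@pre 0) = z \o f by apply/funext => -[|[[]]].
    by rewrite !fE; exact: same_type_reindex.
  pose f (u : W + 'I_k.+1 * V) : (W + 'I_k * V) + V := match u with
    | inl w => inl (inl w)
    | inr iv => if unlift ord_max iv.1 is Some j then inl (inr (j, iv.2))
                else inr iv.2
    end.
  have fE (z : W -> M) : cat_env z (@pre k.+1) =
      cat_env (cat_env z (@pre k)) (a k) \o f.
    apply/funext => -[//|[i v]]; rewrite /f /pre /=.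
    by case: unliftP => [j ->|-> //]; rewrite lift_max.
  rewrite !fE; apply: same_type_reindex.
  have sub z : E `|` range z `<=` B ->
      E `|` range (cat_env z (@pre k)) `<=` B `|` initial a k.
    move=> zB c [Ec|[[w|[i v]] _ <-]]; first by left; apply: zB; left.
      by left; apply: zB; right; exists w.
    by right; exists i, v.
  by apply: avg_same_type IHk _ _ => //; apply: avg_sub (aM k); exact: sub.
apply: same_typeP => X [phi pE ->] /= px.
pose bounded k : set ((W + nat * V) + M) := [set u |
  match u with inl (inr iv) => (iv.1 < k)%N | _ => True end].
have [k pk] : exists k, fv phi `<=` bounded k.
  apply: finite_chain (fv_finite phi) _.
    by move=> k l kl [[//|[i v]]|//] /= /leq_trans; apply.
  by move=> [[w|[i v]]|c] _; [exists 0|exists i.+1 => /=|exists 0].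
(* [inord] needs a nonempty ordinal type, hence the initial segment of length [k.+1]. *)
pose f (u : W + nat * V) : W + 'I_k.+1 * V := match u with
  | inl w => inl w | inr iv => inr (inord iv.1, iv.2) end.
have fE z : sat phi (cat_env (cat_env z (fun iv : nat * V => a iv.1 iv.2)) id) <->
    sat phi (cat_env (cat_env z (@pre k.+1) \o f) id).
  apply sat_eq_fv => -[[//|[i v]]|//] /pk /= ik.
  by rewrite /pre /= inordK // ltnS ltnW.
apply/fE; move/fE: px.
by apply (same_type_reindex f (pre_xy k.+1)).
Qed.

End Indiscernible.

Lemma indiscernible_sub V E E' (a : nat -> V -> M) :
  E `<=` E' -> indiscernible E' a -> indiscernible E a.
Proof.
by move=> EE' aE k s t s_inc t_inc; apply: same_type_sub EE' _; exact: aE.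
Qed.

(** That [b] is indiscernible over [a] is [morley_indiscernible]. Conversely, increasing subtuples
    of [a] have the same type over [E], and [morley_same_type] adds [b] to both sides. *)
Lemma morley_mutual (V1 V2 : finType) E (F1 : set_system (V1 -> M))
    (F2 : set_system (V2 -> M)) a b :
  UltraFilter F1 -> F1 [set c | forall v, E (c v)] ->
  UltraFilter F2 -> F2 [set c | forall v, E (c v)] ->
  morley E F1 a -> morley (E `|` entries a) F2 b ->
  mutually_indiscernible E a b.
Proof.
move=> F1U F1E F2U F2E aM bM; split; last first.
  apply: (morley_indiscernible F2U) bM.
  by apply: filterS F2E => c cE v; left.
move=> k s t s_inc t_inc; apply: same_typeP => X.
pose b' (iv : nat * V2) := b iv.1 iv.2.
rewrite (_ : entries b = range b'); last first.
  apply/seteqP; split=> c; first by move=> [i [v <-]]; exists (i, v).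
  by move=> [[i v] _ <-]; exists i, v.
move=> /definable_split[Y Yd ->] /=.
have sub (r : 'I_k -> nat) :
    E `|` range (fun iv : 'I_k * V1 => a (r iv.1) iv.2) `<=` E `|` entries a.
  by apply: setUS => _ [[i v] _ <-]; exists (r i), v.
have ast := morley_indiscernible F1U F1E aM s_inc t_inc.
exact: (same_type_def (morley_same_type F2U F2E (sub s) (sub t) bM ast) Yd).1.
Qed.

End Average.

(** * Elementary submodels and ultrapowers *)

Section LowenheimSkolem.
Variables (L : language) (M : structure L) (K : Type).
Hypotheses (K_limit : strong_limit K) (L_small : small K [set: formula L nat]).

Lemma nat_small_of_language : small K [set: nat].
Proof.
apply: (@smallT_inj _ _ _ (fun k : nat => Eq (Var L k) (Var L k))) => //.
by move=> k l [].
Qed.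

(** Skolem functions: variable [0] is the one to be witnessed, variable [i.+1] stands for entry [i]
    of the list, and [d] fills the positions past its end. *)
Lemma skolem_ex (d : M) : exists sk : formula L nat * seq M -> M, forall phi s,
  (exists x, sat phi (nth d (x :: s))) -> sat phi (nth d (sk (phi, s) :: s)).
Proof.
have [|sk skP] := @choice _ _ (fun ps x =>
    (exists y, sat ps.1 (nth d (y :: ps.2))) -> sat ps.1 (nth d (x :: ps.2))).
  move=> [phi s] /=; have [[x px]|no] := EM (exists y, sat phi (nth d (y :: s))).
    by exists x.
  by exists d.
by exists sk => phi s; exact: (skP (phi, s)).
Qed.

Section Hull.
Variables (d : M) (sk : formula L nat * seq M -> M) (A : set M).
Hypothesis skP : forall phi s,
  (exists x, sat phi (nth d (x :: s))) -> sat phi (nth d (sk (phi, s) :: s)).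

(** Skolem terms are coded as trees, whose number is bounded by [smallT_tree]: a leaf is an element
    of [A], a node whose first child is a formula applies its Skolem function, and any other tree
    denotes [d]. *)
Fixpoint skolem_eval (t : GenTree.tree ({a | A a} + formula L nat)) : M :=
  match t with
  | GenTree.Leaf (inl a) => sval a
  | GenTree.Node _ (GenTree.Leaf (inr phi) :: ts) =>
      sk (phi, map skolem_eval ts)
  | _ => d
  end.

Definition hull : set M := range skolem_eval.

Lemma hull_sub : A `<=` hull.
Proof. by move=> a Aa; exists (GenTree.Leaf (inl (exist _ a Aa))). Qed.

Lemma hull_sk phi (s : seq M) :
  (forall i, hull (nth d s i)) -> hull (sk (phi, s)).
Proof.
move=> sH; suff [ts ->] : exists ts, s = map skolem_eval ts.
  by exists (GenTree.Node 0 (GenTree.Leaf (inr phi) :: ts)).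
elim: s sH => [|x s IHs] sH; first by exists [::].
have [t _ tx] := sH 0; have [ts ->] := IHs (fun i => sH i.+1).
by exists (t :: ts); rewrite /= tx.
Qed.

Lemma hull_d : hull d.
Proof. by exists (GenTree.Node 0 [::]). Qed.

Definition seq_of_fun k (xs : 'I_k -> M) := [seq xs i | i <- enum 'I_k].

Lemma nth_seq_of_fun k (xs : 'I_k -> M) (i : 'I_k) : nth d (seq_of_fun xs) i = xs i.
Proof. by rewrite (nth_map i) ?size_enum_ord// nth_ord_enum. Qed.

Lemma hull_seq_of_fun k (xs : 'I_k -> M) : (forall i, hull (xs i)) ->
  forall i, hull (nth d (seq_of_fun xs) i).
Proof.
move=> xsH i; have [i_lt|i_ge] := ltnP i k.
  by have := nth_seq_of_fun xs (Ordinal i_lt) => /= ->.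
rewrite nth_default; first exact: hull_d.
by rewrite /seq_of_fun size_map size_enum_ord.
Qed.

(** The value is the only witness of the formula stating that variable [0] equals [f] of the others,
    so the Skolem function of that formula returns it. *)
Lemma hull_fun f xs : (forall i, hull (xs i)) -> hull (@fun_interp L M f xs).
Proof.
move=> xsH; pose phi := Eq (Var L 0) (App (f := f) (fun i => Var L i.+1)).
have /= : sat phi (nth d (sk (phi, seq_of_fun xs) :: seq_of_fun xs)).
  apply: skP; exists (fun_interp xs) => /=; congr fun_interp.
  by apply/funext => i; rewrite nth_seq_of_fun.
rewrite (_ : (fun i => _) = xs); last by apply/funext => i; rewrite nth_seq_of_fun.
by move=> <-; apply: hull_sk; exact: hull_seq_of_fun.
Qed.

Definition hull_structure : structure L :=
  @Structure L {x | hull x} (inhabits (exist _ d hull_d))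
    (fun f xs => exist _ _ (@hull_fun f (fun i => sval (xs i)) (fun i => svalP (xs i))))
    (fun r xs => @rel_interp L M r (fun i => sval (xs i))).

Lemma eval_hull V (t : term L V) (e : V -> hull_structure) :
  sval (eval e t) = eval (fun v => sval (e v)) t.
Proof. by elim: t => //= s ts IH; congr fun_interp; apply/funext. Qed.

(** The Tarski-Vaught criterion: a counterexample to a universal formula can be replaced by the
    value of a Skolem function, which lies in the hull. *)
Lemma sat_hull V (phi : formula L V) (e : V -> hull_structure) :
  sat phi e <-> sat phi (fun v => sval (e v) : M).
Proof.
move: e; induction phi as [V|V t u|V r ts|V phi IH1 psi IH2|V phi IH] => e //=.
- rewrite -!eval_hull; split=> [->//|tu].
  by case: (eval e t) (eval e u) tu => x Hx [y Hy] /= xy; exact/eq_exist.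
- by rewrite (_ : (fun i => sval _) = fun i => eval (fun v => sval (e v)) (ts i)) //;
    apply/funext => i; rewrite eval_hull.
- by rewrite IH1 IH2.
split=> all; last first.
  move=> x; apply/IH; move: (all (sval x)).
  by congr (sat phi _); apply/funext => -[].
apply: contrapT => /existsNP[x0 nx0].
have [k [b [r [_ br]]]] := @finite_enum _ (fv phi) None (fv_finite phi).
(* The finitely many free variables are numbered in the format of the Skolem functions, with [0] for
   the bound one. *)
pose psi := Neg (rename (fun o => if o is Some _ then (r o : nat).+1 else 0) phi).
pose s := seq_of_fun (fun i => if b i is Some v then sval (e v) else d).
have sE x : sat psi (nth d (x :: s)) <->
    ~ sat phi (fun o => if o is Some v then sval (e v) else x).
  rewrite /psi sat_Neg sat_rename; split; apply: contra_not; apply sat_eq_fv.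
    by move=> [v|//] pv /=; rewrite nth_seq_of_fun br.
  by move=> [v|//] pv /=; rewrite nth_seq_of_fun br.
have /sE nsk : sat psi (nth d (sk (psi, s) :: s)).
  by apply: skP; exists x0; apply/sE.
have skH : hull (sk (psi, s)).
  apply: hull_sk; apply: hull_seq_of_fun => i.
  by case: (b i) => [v|]; [exact: svalP|exact: hull_d].
apply: nsk; move: (all (exist _ _ skH)) => /IH.
by congr (sat phi _); apply/funext => -[].
Qed.

Lemma hull_elementary : elementary_submodel hull.
Proof.
exists hull_structure, (fun x => sval x); split.
  by move=> phi; rewrite sat_hull.
by apply/seteqP; split=> [x Hx|_ [[x Hx] _ <-]] //; exists (exist _ x Hx).
Qed.

End Hull.

Lemma small_elementary_submodel (A : set M) : small K A ->
  exists M0, [/\ small K M0, elementary_submodel M0 & A `<=` M0].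
Proof.
move=> As; have [d] := carrier_inhabited M; have [sk skP] := skolem_ex d.
exists (hull d sk A); split; [|exact: hull_elementary|exact: hull_sub].
apply: small_image; have nat_small := nat_small_of_language.
apply: smallT_tree => //; apply: smallT_sum => //.
apply: (smallT_inj (f := fun a : {a | A a} => SigSub (mem_set (svalP a)) : A))
  (smallT_set As).
move=> [a Aa] [b Ab] /(congr1 val)/= ab; exact/eq_exist.
Qed.

End LowenheimSkolem.

(** * Ultrapowers and the realization of global types *)

Section Ultrapower.
Variables (L : language) (C : structure L) (I : Type) (U : set_system I).
Hypothesis U_ultra : UltraFilter U.

Definition ueq (f g : I -> C) := U [set i | f i = g i].

Definition ucls (f : I -> C) : set (I -> C) := [set g | ueq f g].

Lemma ueq_sym f g : ueq f g -> ueq g f.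
Proof. by apply: filterS => i /= ->. Qed.

Lemma ueq_trans f g h : ueq f g -> ueq g h -> ueq f h.
Proof. by move=> fg gh; apply: filterS (filterI fg gh) => i /= [-> ->]. Qed.

Lemma ucls_eq f g : ucls f = ucls g <-> ueq f g.
Proof.
split=> [fg|fg].
  have : ucls g g by apply: filterS filterT.
  by rewrite -fg.
apply/seteqP; split=> h; last exact: ueq_trans.
exact/ueq_trans/ueq_sym.
Qed.

(** Elements are the equivalence classes themselves, as sets of functions; [rep] chooses a
    representative. *)
Definition ultra_carrier := {c : set (I -> C) | exists f, c = ucls f}.

Definition cls f : ultra_carrier := exist _ (ucls f) (ex_intro _ f erefl).

Definition rep (c : ultra_carrier) : I -> C := sval (cid (svalP c)).

Lemma cls_eq f g : cls f = cls g <-> ueq f g.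
Proof.
rewrite -ucls_eq; split=> [/(congr1 sval)//|fg].
exact/eq_exist.
Qed.

Lemma repK c : cls (rep c) = c.
Proof.
rewrite /rep; case: cid => f fE; case: c fE => c cP /= fE.
exact/eq_exist.
Qed.

Lemma rep_cls f : ueq (rep (cls f)) f.
Proof. by apply/cls_eq; rewrite repK. Qed.

Lemma ultra_inhabited : inhabited ultra_carrier.
Proof. by have [d] := carrier_inhabited C; exact: inhabits (cls (fun=> d)). Qed.

Definition ultrapower : structure L :=
  @Structure L ultra_carrier ultra_inhabited
    (fun s xs => cls (fun i => fun_interp (fun k => rep (xs k) i)))
    (fun r xs => U [set i | @rel_interp L C r (fun k => rep (xs k) i)]).

Lemma rep_cls_forall k (f : 'I_k -> I -> C) :
  U [set i | (fun j => rep (cls (f j)) i) = f^~ i].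
Proof.
have : \forall i \near U, forall j, rep (cls (f j)) i = f j i.
  by apply: filter_forall => j; exact: rep_cls.
by apply: filterS => i fi; exact/funext.
Qed.

Lemma eval_ultrapower V (t : term L V) (f : V -> I -> C) :
  @eval L ultrapower V (fun v => cls (f v)) t = cls (fun i => eval (f^~ i) t).
Proof.
elim: t => //= s ts IH; apply/cls_eq.
have := rep_cls_forall (fun k i => eval (f^~ i) (ts k)).
apply: filterS => i /= <-; congr fun_interp; apply/funext => k.
by rewrite IH.
Qed.

(** By induction on [phi]. That [U] is an ultrafilter is used for implications and for quantifiers,
    where failure on a set of [U] yields one function choosing a counterexample at each index. *)
Lemma los V (phi : formula L V) (f : V -> I -> C) :
  @sat L ultrapower V phi (fun v => cls (f v)) <-> U [set i | sat phi (f^~ i)].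
Proof.
move: f; induction phi as [V|V t u|V r ts|V phi IH1 psi IH2|V phi IH] => f /=.
- by split=> // U0; have [] := filter_ex U0.
- by rewrite !eval_ultrapower cls_eq.
- have E := rep_cls_forall (fun k i => eval (f^~ i) (ts k)).
  have -> : [set i | @rel_interp L C r (fun k => rep (@eval L ultrapower V
        (fun v => cls (f v)) (ts k)) i)] = [set i | @rel_interp L C r
        (fun k => rep (cls (fun i => eval (f^~ i) (ts k))) i)].
    apply/funext => i; rewrite /mkset; congr rel_interp.
    by apply/funext => k; rewrite eval_ultrapower.
  by split=> Ur; apply: filterS (filterI Ur E) => i /= [Ri Ei]; move: Ri; rewrite Ei.
- rewrite IH1 IH2; split=> [imp|Uimp Uphi]; last first.
    by apply: filterS (filterI Uimp Uphi) => i /= [pq /pq].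
  have [/imp Upsi|Unphi] := in_ultra_setVsetC [set i | sat phi (f^~ i)] U_ultra.
    by apply: filterS Upsi => i ?.
  by apply: filterS Unphi => i /= np /np.
have env (c : I -> C) : (fun o => if o is Some v then cls (f v) else cls c) =
    (fun o => cls (if o is Some v then f v else c)) by apply/funext => -[].
split=> [all|Uall c]; last first.
  rewrite -(repK c) env; apply/IH; apply: filterS Uall => i /= /(_ (rep c i)).
  by congr (sat phi _); apply/funext => -[].
have [//|Unall] := in_ultra_setVsetC
  [set i | forall x, sat phi (fun o => if o is Some v then f v i else x)] U_ultra.
have [|h hP] := @choice _ _ (fun i x =>
    (~ forall x, sat phi (fun o => if o is Some v then f v i else x)) ->
    ~ sat phi (fun o => if o is Some v then f v i else x)).
  move=> i; have [all_i|nall] := EM (forall x, sat phi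
      (fun o => if o is Some v then f v i else x)).
    by have [d] := carrier_inhabited C; exists d => /(_ all_i).
  by have [x nx] := (existsNP _).2 nall; exists x.
have := all (cls h); rewrite env => /IH Uh.
have [i [/= /hP + hi]] := filter_ex (filterI Unall Uh); case.
by move: hi; congr (sat phi _); apply/funext => -[].
Qed.

Lemma ultrapower_elementary : elementary (fun a : C => cls (fun=> a) : ultrapower).
Proof.
move=> phi; rewrite los /=; split=> [p|Up]; last by have [] := filter_ex Up.
by apply: filterS filterT.
Qed.

End Ultrapower.

Lemma global_type_realized L (C : structure L) V (q : set (formula L (V + C))) :
  finitely_satisfiable q -> exists (N : structure L) (j : C -> N) (x : V -> N),
    elementary j /\ realizes j x q.
Proof.
move=> qfin.
(* The index set of the ultrapower is the set of tuples; [F] is generated by the sets of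
   realizations of finite parts of [q], and the classes of the coordinate functions will realize
   [q]. *)
pose F : set_system (V -> C) := [set S | exists p0, [/\ finite_set p0,
  p0 `<=` q & realizations p0 `<=` S]].
have FF : ProperFilter F.
  apply: Build_ProperFilter_ex.
    by move=> S [p0 [p0f p0q p0S]]; have [x /p0S] := qfin p0 p0f p0q; exists x.
  split.
  - by exists set0; split => //; exact: finite_set0.
  - move=> S S' [p0 [p0f p0q p0S]] [p1 [p1f p1q p1S]].
    exists (p0 `|` p1); split; first by rewrite finite_setU.
      by move=> phi [/p0q|/p1q].
    move=> x xp; split; [apply: p0S|apply: p1S] => phi pphi; apply: xp;
      [by left|by right].
  - move=> S S' SS' [p0 [p0f p0q p0S]]; exists p0; split => //.
    exact: subset_trans p0S SS'.
have [U [UU FU]] := ultraFilterLemma FF.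
pose c : ((V -> C) -> C) -> ultrapower C U := @cls L C _ U.
exists (ultrapower C U), (fun a => c (fun=> a)), (fun v => c (fun x => x v)).
split; first exact: ultrapower_elementary.
move=> phi qphi.
have -> : cat_env (fun v => c (fun x : V -> C => x v)) (fun a => c (fun=> a)) =
    (fun u => c (fun x => cat_env x id u)) by apply/funext => -[].
apply/los; apply: FU; exists [set phi]; split.
- exact: finite_set1.
- by move=> _ ->.
- by move=> x; apply.
Qed.

(** * Definable sets of group elements *)

Local Open Scope group_scope.

Lemma definable_forall L (M : structure L) (J : finType) V (A : set M)
    (X : J -> set (V -> M)) :
  (forall j, definable A (X j)) -> definable A [set x | forall j, X j x].
Proof.
move=> Xd; suff : definable A [set x | forall j, j \in enum J -> X j x].
  by apply: definable_iff => x /=; split=> [all j|all j _]; apply: all; rewrite ?mem_enum.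
elim: (enum J) => [|j s IHs].
  by apply: definable_iff (definableT V A) => x.
apply: definable_iff (definableI (Xd j) IHs) => x /=; split.
  by move=> [Xj Xs] i; rewrite inE => /orP[/eqP->|/Xs].
move=> Xjs; split=> [|i si]; first exact/Xjs/mem_head.
by apply: Xjs; rewrite inE si orbT.
Qed.

Section GroupDefinable.
Variables (L : language) (C : structure L) (gT : groupType) (n : nat).
Variable D : definable_group C gT n.
Implicit Types (A E : set C).

Definition flat V (g : V -> gT) (vi : V * 'I_n) : C := pt D (g vi.1) vi.2.

(* Tuples of group elements are read as tuples of elements of [C] through [pt D]. *)
Definition gdef V A (R : set (V -> gT)) :=
  exists2 X : set (V * 'I_n -> C), definable A X & forall g, R g <-> X (flat g).

Definition gbase A :=
  definable A [set x | sat (dom D) (cat_env x id)] /\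
  definable A [set xyz | sat (Defs.mul D) (cat_env xyz id)].

Lemma gbase_sub A E : A `<=` E -> gbase A -> gbase E.
Proof. by move=> AE [dA mA]; split; apply: definable_sub AE _. Qed.

Lemma gdef_sub V A E (R : set (V -> gT)) : A `<=` E -> gdef A R -> gdef E R.
Proof. by move=> AE [X Xd RX]; exists X => //; apply: definable_sub AE _. Qed.

Lemma gdef_iff V A (R S : set (V -> gT)) :
  (forall g, R g <-> S g) -> gdef A R -> gdef A S.
Proof. by move=> RS [X Xd RX]; exists X => // g; rewrite -RS. Qed.

Lemma gdefC V A (R : set (V -> gT)) : gdef A R -> gdef A [set g | ~ R g].
Proof.
move=> [X Xd RX]; exists (~` X); first exact: definableC.
by move=> g /=; rewrite RX.
Qed.

Lemma gdefI V A (R S : set (V -> gT)) :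
  gdef A R -> gdef A S -> gdef A [set g | R g /\ S g].
Proof.
move=> [X Xd RX] [Y Yd SY]; exists (X `&` Y); first exact: definableI.
by move=> g /=; rewrite RX SY.
Qed.

Lemma gdefT V A : gdef A [set: V -> gT].
Proof. by exists setT => //; exact: definableT. Qed.

Lemma gdef_reindex V W A (f : V -> W) (R : set (V -> gT)) :
  gdef A R -> gdef A [set g : W -> gT | R (g \o f)].
Proof.
move=> [X Xd RX].
exists [set x : W * 'I_n -> C | X (x \o (fun vi => (f vi.1, vi.2)))]; first exact: definable_reindex.
by move=> g /=; rewrite RX.
Qed.

Definition ext V (g : V -> gT) (h : gT) (o : option V) : gT :=
  if o is Some v then g v else h.

Lemma gdef_inst V A (R : set (option V -> gT)) c : (forall i, A (pt D c i)) ->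
  gdef A R -> gdef A [set g | R (ext g c)].
Proof.
move=> cA [X Xd RX].
pose f (vi : option V * 'I_n) : V * 'I_n + C :=
  if vi.1 is Some v then inl (v, vi.2) else inr (pt D c vi.2).
exists [set x : V * 'I_n -> C | X (cat_env x id \o f)].
  by apply: definable_subst Xd => -[[v|] i] //= a [<-].
move=> g /=; rewrite RX (_ : flat (ext g c) = cat_env (flat g) id \o f) //.
by apply/funext => -[[v|] i].
Qed.

Section Base.
Variable A : set C.
Hypothesis A_base : gbase A.

(** A quantifier over group elements is one over [n]-tuples restricted to [dom D]. *)
Lemma gdef_ex V (R : (V -> gT) -> gT -> Prop) :
  gdef A [set g : option V -> gT | R (g \o Some) (g None)] ->
  gdef A [set g | exists h, R g h].
Proof.
move=> [X Xd RX].
exists [set x : V * 'I_n -> C | exists y, sat (dom D) (cat_env y id) /\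
    X (fun vi => if vi.1 is Some v then x (v, vi.2) else y vi.2)].
  pose f (vi : option V * 'I_n) : V * 'I_n + 'I_n :=
    if vi.1 is Some v then inl (v, vi.2) else inr vi.2.
  have Yd := definableI (definable_reindex inr A_base.1) (definable_reindex f Xd).
  apply: definable_iff (definable_ex Yd) => x /=.
  have E y : cat_env x y \o f =
      (fun vi => if vi.1 is Some v then x (v, vi.2) else y vi.2).
    by apply/funext => -[[v|] i].
  by split=> -[y Yy]; exists y; move: Yy; rewrite E.
move=> g /=; have E h : (fun vi : option V * 'I_n => if vi.1 is Some v
    then flat g (v, vi.2) else pt D h vi.2) = flat (ext g h).
  by apply/funext => -[[v|] i].
split=> [[h Rgh]|[y [/domP[h <-]]]].
  exists (pt D h); split; first by apply/domP; exists h.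
  by rewrite E -RX.
by rewrite E -RX => Rgh; exists h.
Qed.

Lemma gdef_mulg V (u v w : V) : gdef A [set g | g u * g v = g w].
Proof.
exists [set x : V * 'I_n -> C | sat (Defs.mul D) (cat_env (cat_env (cat_env (fun i => x (u, i))
    (fun i => x (v, i))) (fun i => x (w, i))) id)].
  pose f (s : 'I_n + 'I_n + 'I_n) := match s with
    | inl (inl i) => (u, i) | inl (inr i) => (v, i) | inr i => (w, i) end.
  apply: definable_iff (definable_reindex f A_base.2) => x /=.
  rewrite (_ : x \o f = cat_env (cat_env (fun i => x (u, i))
    (fun i => x (v, i))) (fun i => x (w, i))) //.
  by apply/funext => -[[]|].
move=> g /=; rewrite mulP; split=> [guv|[a [b [ga gb gab]]]].
  by exists (g u), (g v); rewrite guv.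
rewrite -(@pt_inj _ _ _ _ D a (g u) ga) -(@pt_inj _ _ _ _ D b (g v) gb).
exact: (@pt_inj _ _ _ _ D).
Qed.

(** Equality comes from multiplication: [e * e = e] forces [e] to be the identity. *)
Lemma gdef_eq_var V (u v : V) : gdef A [set g | g u = g v].
Proof.
apply: (@gdef_iff _ _ [set g | exists e, e * e = e /\ g u * e = g v]).
  move=> g /=; split=> [[e [ee <-]]|<-]; last by exists 1; rewrite !mulg1.
  by have -> : e = 1; [apply: (mulgI e); rewrite ee mulg1|rewrite mulg1].
apply: (gdef_ex (R := fun g e => e * e = e /\ g u * e = g v)) => /=.
by apply: gdefI; exact: gdef_mulg.
Qed.

(** Definability of the graph of [t], with the value in the variable [None]. The closure lemmas
    below make definability of a condition on group words a matter of its syntax. *)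
Definition gfun V (t : (V -> gT) -> gT) :=
  gdef A [set g : option V -> gT | g None = t (g \o Some)].

Lemma gdef_comp V (R : set (option V -> gT)) (t : (V -> gT) -> gT) :
  gfun t -> gdef A R -> gdef A [set g | R (ext g (t g))].
Proof.
move=> t_fun Rd; apply: (@gdef_iff _ _ [set g | exists h, h = t g /\ R (ext g h)]).
  by move=> g; split=> [[h [->]]|Rg] //; exists (t g).
apply: (gdef_ex (R := fun g h => h = t g /\ R (ext g h))).
apply: gdefI t_fun _; apply: gdef_iff Rd => g /=.
by rewrite (_ : ext _ _ = g) //; apply/funext => -[].
Qed.

Lemma gfun_reindex V W (f : V -> W) (t : (V -> gT) -> gT) :
  gfun t -> gfun (fun g : W -> gT => t (g \o f)).
Proof. exact: (gdef_reindex (omap f)). Qed.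

Lemma gdef_eq V (s t : (V -> gT) -> gT) :
  gfun s -> gfun t -> gdef A [set g | s g = t g].
Proof. by move=> s_fun t_fun; exact: (gdef_comp s_fun t_fun). Qed.

Lemma gfun_proj V (v : V) : gfun (fun g => g v).
Proof. exact: gdef_eq_var. Qed.

Lemma gfun_mul V (s t : (V -> gT) -> gT) :
  gfun s -> gfun t -> gfun (fun g => s g * t g).
Proof.
move=> s_fun t_fun.
(* The first two variables are to be filled with the values of [s] and [t]; the third is the
   product. *)
have Rd := @gdef_mulg (option (option (option V))) (Some None) None (Some (Some None)).
have := gdef_comp (gfun_reindex Some s_fun)
  (gdef_comp (gfun_reindex (Some \o Some) t_fun) Rd).
by apply: gdef_iff => g /=; split=> ->.
Qed.

Lemma gfun_one V : gfun (fun _ : V -> gT => 1).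
Proof.
apply: gdef_iff (gdef_mulg None None None) => g /=; split=> [gg|->]; last by rewrite mulg1.
by apply: (mulgI (g None)); rewrite gg mulg1.
Qed.

Lemma gfun_inv V (t : (V -> gT) -> gT) : gfun t -> gfun (fun g => (t g)^-1).
Proof.
move=> t_fun; have := gdef_eq (gfun_mul (gfun_proj None)
  (gfun_reindex Some t_fun)) (@gfun_one (option V)).
apply: gdef_iff => g /=; split=> [gt|->]; last by rewrite mulVg.
by rewrite -[LHS]mulg1 -(mulgV (t (g \o Some))) mulgA gt mul1g.
Qed.

Lemma gfun_const V c : (forall i, A (pt D c i)) -> gfun (fun _ : V -> gT => c).
Proof.
move=> cA; apply: gdef_iff (gdef_inst cA (@gdef_eq_var (option (option V))
  (Some None) None)) => g //.
Qed.

Lemma gfun_exp V (t : (V -> gT) -> gT) k : gfun t -> gfun (fun g => t g ^+ k).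
Proof.
move=> t_fun; elim: k => [|k IHk]; first exact: gfun_one.
apply: gdef_iff (gfun_mul t_fun IHk) => g /=.
by rewrite expgS.
Qed.

Lemma gfun_conj V (s t : (V -> gT) -> gT) :
  gfun s -> gfun t -> gfun (fun g => s g ^ t g).
Proof.
by move=> s_fun t_fun; apply: gfun_mul; [exact: gfun_inv|exact: gfun_mul].
Qed.

Lemma gfun_comm V (s t : (V -> gT) -> gT) :
  gfun s -> gfun t -> gfun (fun g => [~ s g, t g]).
Proof.
by move=> s_fun t_fun; apply: gfun_mul; [exact: gfun_inv|exact: gfun_conj].
Qed.

Lemma gdef_app V (U : set gT) (t : (V -> gT) -> gT) :
  gdef A [set g : unit -> gT | U (g tt)] -> gfun t -> gdef A [set g | U (t g)].
Proof.
move=> Ud t_fun; exact: (gdef_comp t_fun (gdef_reindex (fun=> None) Ud)).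
Qed.

End Base.

Lemma gdef_forall V A (J : finType) (R : J -> set (V -> gT)) :
  (forall j, gdef A (R j)) -> gdef A [set g | forall j, R j g].
Proof.
move=> Rd; have [X XP] := choice (fun j => (let: ex_intro2 X Xd RX := Rd j in
  ex_intro _ X (conj Xd RX) : exists X, definable A X /\ forall g, R j g <-> X (flat g))).
exists [set x | forall j, X j x]; first by apply: definable_forall => j; case: (XP j).
by move=> g; split=> all j; have := all j; rewrite (XP j).2.
Qed.

Variable K : Type.
Hypothesis sat_C : saturated K C.

Lemma gsat (V : finType) J (Q : set J) (R : J -> set (V -> gT)) A :
  small K A -> gbase A -> Q !=set0 -> (forall j, Q j -> gdef A (R j)) ->
  (forall i j, Q i -> Q j -> exists2 k, Q k & R k `<=` R i `&` R j) ->
  (forall j, Q j -> R j !=set0) -> exists g, forall j, Q j -> R j g.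
Proof.
move=> As A_base [j0 Qj0] Rd Rdir Rne.
(* Images under [flat] are definable because the coordinates of each entry are required to satisfy
   [dom D]. Since [flat] is injective, a common point of the images comes from a single tuple of
   group elements. *)
pose img (S : set (V -> gT)) : set (V * 'I_n -> C) := (@flat V) @` S.
have img_def S : gdef A S -> definable A (img S).
  move=> [X Xd SX].
  have domd : definable A [set x : V * 'I_n -> C | forall v,
      sat (dom D) (cat_env (fun i => x (v, i)) id)].
    apply: definable_forall => v.
    exact: (definable_reindex (fun i => (v, i)) A_base.1).
  apply: definable_iff (definableI Xd domd) => x; split.
    move=> [Xx /= /(_ _)/domP xdom]; have [g gx] := choice xdom.
    have <- : flat g = x by apply/funext => -[v i]; rewrite /flat /= gx.
    exists g => //; apply/SX; move: Xx; congr X; apply/funext => -[v i].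
    by rewrite /flat /= gx.
  by move=> [g /SX Xg <-]; split => // v; apply/domP; exists (g v).
have flat_inj : injective (@flat V).
  by move=> g h /(congr1 (fun x v i => x (v, i))) gh; apply/funext => v;
     apply: (@pt_inj _ _ _ _ D); exact: (congr1 (fun x => x v) gh).
have [||||x xP] := @saturated_directed _ _ _ sat_C _ A (img @` (R @` Q)) As.
- by move=> _ [_ [j Qj <-] <-]; exact/img_def/Rd.
- by exists (img (R j0)), (R j0) => //; exists j0.
- move=> _ _ [_ [i Qi <-] <-] [_ [j Qj <-] <-].
  have [k Qk RkR] := Rdir i j Qi Qj; exists (img (R k)).
    by exists (R k) => //; exists k.
  by move=> _ [g /RkR[Rig Rjg] <-]; split; exists g.
- by move=> _ [_ [j Qj <-] <-]; have [g Rg] := Rne j Qj; exists (flat g), g.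
have img_x j : Q j -> img (R j) x by move=> Qj; apply: xP; exists (R j) => //; exists j.
have [g _ gx] := img_x j0 Qj0; exists g => j /img_x[h Rh]; rewrite -gx.
by move=> /flat_inj <-.
Qed.

Definition gdef1 A (U : set gT) := gdef A [set g : unit -> gT | U (g tt)].

Definition nbhd A (H : set gT) : set (set gT) := [set U | gdef1 A U /\ H `<=` U].

(* Type-definability over [A]: [H] is the intersection of its [A]-definable
   supersets. *)
Definition gtd A (H : set gT) := forall x, (forall U, nbhd A H U -> U x) -> H x.

Lemma nbhdI A H U W : nbhd A H U -> nbhd A H W -> nbhd A H (U `&` W).
Proof.
move=> [Ud HU] [Wd HW]; split; first exact: gdefI.
by move=> x Hx; split; [exact: HU|exact: HW].
Qed.

Lemma nbhdT A H : nbhd A H setT.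
Proof. by split=> //; exact: gdefT. Qed.

Lemma gtd_sub A E H : A `<=` E -> gtd A H -> gtd E H.
Proof.
move=> AE Htd x xU; apply: Htd => U [Ud HU]; apply: xU; split => //.
exact: gdef_sub AE Ud.
Qed.

Lemma type_definable_gtd A H : type_definable A (pt D @` H) -> gtd A H.
Proof.
move=> [p pA HE] x xU.
suff : (pt D @` H) (pt D x) by move=> [y Hy /pt_inj <-].
rewrite HE => phi pphi.
have := xU [set y | sat phi (cat_env (pt D y) id)]; apply; split.
  exists [set z : unit * 'I_n -> C | sat phi (cat_env (z \o pair tt) id)].
    apply: (definable_reindex (pair tt) (X := [set z | sat phi (cat_env z id)])).
    by exists phi => //; exact: pA.
  by move=> g.
move=> y Hy; have : realizations p (pt D y) by rewrite -HE; exists y.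
exact.
Qed.

Lemma gtd_type_definable A H : gbase A -> gtd A H -> type_definable A (pt D @` H).
Proof.
move=> A_base Htd.
(* All formulas over [A] true on [H] are taken; one of them defines the domain of the group, so that
   every realization is a point of the group. *)
exists [set phi | Defs.over A phi /\ forall h, H h -> sat phi (cat_env (pt D h) id)].
  by move=> phi [].
apply/seteqP; split=> x; first by move=> [h Hh <-] phi [_]; apply.
move=> xp; have [phi phiA phiE] := A_base.1.
have /domP[g gx] : sat (dom D) (cat_env x id).
  change ([set x | sat (dom D) (cat_env x id)] x); rewrite phiE /=.
  apply: xp; split=> // h _.
  change ([set x | sat phi (cat_env x id)] (pt D h)); rewrite -phiE /=.
  by apply/domP; exists h.
exists g => //; apply: Htd => U [[X Xd UX] HU].
have [psi psiA psiE] := definable_reindex (@snd unit 'I_n) Xd.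
apply/(UX (fun=> g)).
change ([set e : 'I_n -> C | X (e \o snd)] (pt D g)); rewrite psiE /= gx.
apply: xp; split=> // h Hh.
change ([set x | sat psi (cat_env x id)] (pt D h)); rewrite -psiE /=.
exact/(UX (fun=> h))/HU.
Qed.

(* Decreasing conditions [S k] that can be met on every definable superset of
   [H] can be met together on [H]. *)
Lemma gsat_td (V : finType) A E H (S : nat -> set (V -> gT)) :
  small K E -> A `<=` E -> gbase A -> gtd A H ->
  (forall k, gdef E (S k)) -> (forall k l, (k <= l)%N -> S l `<=` S k) ->
  (forall U k, nbhd A H U -> exists g, (forall v, U (g v)) /\ S k g) ->
  exists g, (forall v, H (g v)) /\ forall k, S k g.
Proof.
move=> Es AE A_base Htd Sd Sdec HS.
have E_base := gbase_sub AE A_base.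
have [||||g gP] := @gsat V (set gT * nat) [set Uk | nbhd A H Uk.1]
  (fun Uk => [set g | (forall v, Uk.1 (g v)) /\ S Uk.2 g]) E Es E_base.
- by exists (setT, 0); exact: nbhdT.
- move=> [U k] [Ud _]; apply: gdefI => //; apply: gdef_forall => v.
  exact: (gdef_app E_base (gdef_sub AE Ud) (gfun_proj E_base v)).
- move=> [U k] [W l] /= HU HW; exists (U `&` W, maxn k l); first exact: nbhdI.
  move=> g /= [gUW gS]; split; split.
  + by move=> v; case: (gUW v).
  + exact: Sdec (leq_maxl k l) _ gS.
  + by move=> v; case: (gUW v).
  + exact: Sdec (leq_maxr k l) _ gS.
- by move=> [U k] HU; exact: HS.
exists g; split=> [v|k]; last exact: (gP (setT, k) (nbhdT A H)).2.
by apply: Htd => U HU; exact: (gP (U, 0) HU).1.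
Qed.

(** Compactness: were there a counterexample in every definable neighborhood of [H], then [gsat_td]
    would find one in [H]. *)
Lemma nbhd_shrink (V : finType) A E H (S : set (V -> gT)) :
  small K E -> A `<=` E -> gbase A -> gtd A H -> gdef E S ->
  (forall g, (forall v, H (g v)) -> S g) ->
  exists2 U, nbhd A H U & forall g, (forall v, U (g v)) -> S g.
Proof.
move=> Es AE A_base Htd Sd HS; apply: contrapT => no.
have [|||g [Hg gS]] := @gsat_td V A E H (fun=> [set g | ~ S g]) Es AE A_base Htd.
- by move=> _; exact: gdefC.
- by move=> k l _ g.
- move=> U k HU; apply: contrapT => noU; apply: no; exists U => // g Ug.
  by apply: contrapT => nS; apply: noU; exists g.
exact: gS 0%N (HS g Hg).
Qed.

End GroupDefinable.

(** * Dp-minimality *)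

(** An ultrafilter containing the tails of [s]: its averages satisfy whatever holds eventually along
    [s]. *)
Lemma ultra_seq T (s : nat -> T) : exists2 F : set_system T, UltraFilter F &
  forall (S : set T) k, (forall i, (k <= i)%N -> S (s i)) -> F S.
Proof.
pose F0 : set_system T := [set S | exists k, forall i, (k <= i)%N -> S (s i)].
have F0F : ProperFilter F0.
  apply: Build_ProperFilter_ex.
    by move=> S [k kS]; exists (s k); exact: kS.
  split; first by exists 0.
    move=> S S' [k kS] [l lS']; exists (maxn k l) => i; rewrite geq_max.
    by move=> /andP[ki li]; split; [exact: kS|exact: lS'].
  by move=> S S' SS' [k kS]; exists k => i /kS/SS'.
have [F [FU F0F']] := ultraFilterLemma F0F.
by exists F => // S k kS; apply: F0F'; exists k.
Qed.

Lemma indiscernible_reindex L (M : structure L) V W A (f : W -> V)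
    (a : nat -> V -> M) :
  indiscernible A a -> indiscernible A (fun i => a i \o f).
Proof.
move=> aA k s t s_inc t_inc.
exact: (same_type_reindex (fun iw => (iw.1, f iw.2)) (aA k s t s_inc t_inc)).
Qed.

Lemma mutually_indiscernible_reindex L (M : structure L) V1 V2 W1 W2 A
    (f1 : W1 -> V1) (f2 : W2 -> V2) (a : nat -> V1 -> M) (b : nat -> V2 -> M) :
  mutually_indiscernible A a b ->
  mutually_indiscernible A (fun i => a i \o f1) (fun i => b i \o f2).
Proof.
move=> [aA bA]; split; apply: indiscernible_reindex.
  apply: indiscernible_sub aA; apply: setUS => c [i [v <-]].
  by exists i, (f2 v).
apply: indiscernible_sub bA; apply: setUS => c [i [v <-]].
by exists i, (f1 v).
Qed.

Definition of_ord (V : finType) (i : 'I_#|V|) : V := enum_val i.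

Definition dp_minimal_over L (C : structure L) (gT : groupType) n
    (D : definable_group C gT n) (G : set gT) (B : set C) : Prop :=
  forall d1 d2 (J1 : orderType d1) (J2 : orderType d2) m1 m2
    (a1 : J1 -> 'I_m1 -> C) (a2 : J2 -> 'I_m2 -> C),
    infinite_set [set: J1] -> infinite_set [set: J2] ->
    mutually_indiscernible B a1 a2 -> forall g, G g ->
    indiscernible (B `|` range (pt D g)) a1 \/
    indiscernible (B `|` range (pt D g)) a2.

Section Grid.
Variables (L : language) (C : structure L) (K : Type) (gT : groupType) (n : nat).
Hypotheses (sat_C : saturated K C) (K_limit : strong_limit K).
Hypothesis nat_small : small K [set: nat].
Variables (D : definable_group C gT n) (G : set gT) (B : set C).
Hypotheses (B_small : small K B) (B_base : gbase D B) (G_td : gtd D B G).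
Hypothesis dp_min : dp_minimal_over D G B.

Definition fiber (W : finType) (X : set (option W * 'I_n -> C))
    (x : W * 'I_n -> C) (y : 'I_n -> C) : Prop :=
  X (fun wi => if wi.1 is Some w then x (w, wi.2) else y wi.2).

Lemma definable_fiber (W : finType) X S E (f : W * 'I_n -> S + C)
    (h : 'I_n -> S + C) :
  definable E X -> (forall v c, f v = inr c -> E c) -> (forall i c, h i = inr c -> E c) ->
  definable E [set e : S -> C | fiber X (cat_env e id \o f) (cat_env e id \o h)].
Proof.
move=> Xd fE hE; pose fh (wi : option W * 'I_n) :=
  if wi.1 is Some w then f (w, wi.2) else h wi.2.
have fhE v c : fh v = inr c -> E c.
  by case: v => [[w|] i]; [exact: fE|exact: hE].
have := definable_subst fhE Xd; apply: definable_iff => e /=.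
have -> : cat_env e id \o fh = fun wi : option W * 'I_n => if wi.1 is Some w
    then cat_env e id (f (w, wi.2)) else cat_env e id (h wi.2).
  by apply/funext => -[[w|] i].
by [].
Qed.

(** Subsequences of length one already suffice: [a 0] and [a 1] have the same type over the point
    [g]. *)
Lemma fiber_indiscernible (W : finType) X (a : nat -> W * 'I_n -> C) g :
  definable B X ->
  indiscernible (B `|` range (pt D g)) (fun i => a i \o @of_ord _) ->
  fiber X (a 0%N) (pt D g) -> fiber X (a 1%N) (pt D g).
Proof.
move=> Xd a_indisc.
have a01 := a_indisc 1%N (fun=> 0%N) (fun=> 1%N).
have {a_indisc}a01 : same_type (B `|` range (pt D g))
    (fun iv : 'I_1 * 'I_#|{: W * 'I_n}| => a 0%N (of_ord iv.2))
    (fun iv : 'I_1 * 'I_#|{: W * 'I_n}| => a 1%N (of_ord iv.2)).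
  by apply: a01 => -[[|//] ?] [[|//] ?].
pose f (v : W * 'I_n) : 'I_1 * 'I_#|{: W * 'I_n}| + C := inl (ord0, enum_rank v).
pose h (i : 'I_n) : 'I_1 * 'I_#|{: W * 'I_n}| + C := inr (pt D g i).
have Yd : definable (B `|` range (pt D g))
    [set e | fiber X (cat_env e id \o f) (cat_env e id \o h)].
  apply: definable_fiber => //; first exact: definable_sub Xd.
  by move=> i c [<-]; right; exists i.
have := (same_type_def a01 Yd).1 => /=.
have fE k : cat_env (fun iv : 'I_1 * 'I_#|{: W * 'I_n}| => a k (of_ord iv.2)) id
    \o f = a k by apply/funext => v; rewrite /= /of_ord enum_rankK.
by rewrite !fE.
Qed.

Lemma avg_inst (V : Type) E (F : set_system (V -> C)) (Y : (V -> C) -> Prop) c k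
    (s : nat -> V -> C) :
  (forall (S : set (V -> C)) k, (forall i, (k <= i)%N -> S (s i)) -> F S) ->
  avg E F c -> definable E Y -> (forall i, (k <= i)%N -> Y (s i)) -> Y c.
Proof. by move=> sF cF Yd sY; apply: cF => //; exact: sF sY. Qed.

(** One point of [P] separates both pairs of parameters. Being definable in the four tuples, this
    passes to averages one tuple at a time. *)
Definition theta (W1 W2 : finType) (P : set ('I_n -> C)) X1 X2
    (x0 x1 : W1 * 'I_n -> C) (y0 y1 : W2 * 'I_n -> C) :=
  exists z, P z /\ (fiber X1 x0 z /\ ~ fiber X1 x1 z) /\
    (fiber X2 y0 z /\ ~ fiber X2 y1 z).

Lemma theta_definable (W1 W2 : finType) P X1 X2 S E
    (x0 x1 : W1 * 'I_n -> S + C) (y0 y1 : W2 * 'I_n -> S + C) :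
  definable E P -> definable E X1 -> definable E X2 ->
  (forall v c, x0 v = inr c -> E c) -> (forall v c, x1 v = inr c -> E c) ->
  (forall v c, y0 v = inr c -> E c) -> (forall v c, y1 v = inr c -> E c) ->
  definable E [set e | theta P X1 X2 (cat_env e id \o x0) (cat_env e id \o x1)
                               (cat_env e id \o y0) (cat_env e id \o y1)].
Proof.
move=> Pd X1d X2d x0E x1E y0E y1E.
pose up V (f : V -> S + C) (v : V) : (S + 'I_n) + C :=
  match f v with inl s => inl (inl s) | inr c => inr c end.
have upE V (f : V -> S + C) : (forall v c, f v = inr c -> E c) ->
    forall v c, up V f v = inr c -> E c.
  by move=> fE v c; rewrite /up; case fv: (f v) => [//|c'] [<-]; exact: fE fv.
have up_env V (f : V -> S + C) e y :
    cat_env (cat_env e y) id \o up V f = cat_env e id \o f.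
  by apply/funext => v /=; rewrite /up; case: (f v).
pose z (i : 'I_n) : (S + 'I_n) + C := inl (inr i).
have zd : definable E [set e : S + 'I_n -> C | P (cat_env e id \o z)].
  exact: definable_subst.
have fd (W : finType) X (f : W * 'I_n -> S + C) : definable E X ->
    (forall v c, f v = inr c -> E c) -> definable E [set e : S + 'I_n -> C |
      fiber X (cat_env e id \o up _ f) (cat_env e id \o z)].
  by move=> Xd fE; apply: definable_fiber => //; exact: upE.
have := definable_ex (definableI zd (definableI
  (definableI (fd _ _ _ X1d x0E) (definableC (fd _ _ _ X1d x1E)))
  (definableI (fd _ _ _ X2d y0E) (definableC (fd _ _ _ X2d y1E))))).
by apply: definable_iff => e /=; split=> -[y yP]; exists y; move: yP; rewrite /= !up_env.
Qed.

(** Averages [a] of the row parameters and [b] of the column parameters are mutually indiscernible,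
    but a single element of [G] separates [a 0] from [a 1] and [b 0] from [b 1]. *)
Lemma dp_minimal_grid (W1 W2 : finType) (u1 : nat -> W1 -> gT)
    (u2 : nat -> W2 -> gT) (v : nat -> nat -> gT)
    (R1 : set (option W1 -> gT)) (R2 : set (option W2 -> gT)) :
  gdef D B R1 -> gdef D B R2 -> (forall i j, G (v i j)) ->
  (forall i j i', R1 (ext (u1 i') (v i j)) <-> i = i') ->
  (forall i j j', R2 (ext (u2 j') (v i j)) <-> j = j') -> False.
Proof.
move=> [X1 X1d R1X] [X2 X2d R2X] Gv R1v R2v.
pose s1 i := flat D (u1 i); pose s2 i := flat D (u2 i).
have fiberE (W : finType) (X : set (option W * 'I_n -> C)) (u : W -> gT) g :
    fiber X (flat D u) (pt D g) = X (flat D (ext u g)).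
  by congr X; apply/funext => -[[w|] i].
have [F1 F1U s1F] := ultra_seq s1; have [F2 F2U s2F] := ultra_seq s2.
pose E := B `|` entries s1 `|` entries s2.
have Es : small K E by do 2?apply: small_setU => //; exact: small_entries.
have F1E : F1 [set c | forall w, E (c w)].
  by apply: (s1F _ 0) => i _ w; left; right; exists i, w.
have F2E : F2 [set c | forall w, E (c w)].
  by apply: (s2F _ 0) => i _ w; right; exists i, w.
have [a aM] := morley_ex sat_C K_limit nat_small _ Es (F := F1).
have Eas : small K (E `|` entries a) by apply: small_setU => //; exact: small_entries.
have [b bM] := morley_ex sat_C K_limit nat_small _ Eas (F := F2).
have EB : B `<=` E by move=> c Bc; left; left.
have ab_indisc : mutually_indiscernible B (fun i => a i \o @of_ord _)
    (fun i => b i \o @of_ord _).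
  apply: mutually_indiscernible_reindex.
  have [aE bE] := morley_mutual F1U F1E F2U F2E aM bM.
  by split; [apply: indiscernible_sub aE|apply: indiscernible_sub bE]; exact: setSU.
have theta_ab U : nbhd D B G U -> exists g, U g /\
    (fiber X1 (a 0%N) (pt D g) /\ ~ fiber X1 (a 1%N) (pt D g)) /\
    (fiber X2 (b 0%N) (pt D g) /\ ~ fiber X2 (b 1%N) (pt D g)).
  move=> [[XU XUd UX] GU].
  pose P := [set z | sat (dom D) (cat_env z id)] `&` [set z : 'I_n -> C | XU (z \o snd)].
  have Pd : definable B P by apply: definableI B_base.1 _; exact: definable_reindex.
  suff [z [[/domP[g <-] Uz] z_ab]] : theta P X1 X2 (a 0%N) (a 1%N) (b 0%N) (b 1%N).
    by exists g; split=> //; exact/(UX (fun=> g)).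
  have PE E' : B `<=` E' -> [/\ definable E' P, definable E' X1 & definable E' X2].
    by move=> BE'; split; apply: definable_sub BE' _.
  (* The parameters are replaced in the order [i0], [i1], [j0], [j1]. When [i0] is replaced, the
     statement holds for all indices beyond [i1], hence on a tail of the sequence; likewise for [j0]
     and [j1]. *)
  have th0 i0 i1 j0 j1 : (i1 < i0)%N -> (j1 < j0)%N ->
      theta P X1 X2 (s1 i0) (s1 i1) (s2 j0) (s2 j1).
    move=> ii jj; exists (pt D (v i0 j0)); rewrite !fiberE -!R1X -!R2X !R1v !R2v.
    split; first by split; [apply/domP; exists (v i0 j0)|exact/(UX (fun=> v i0 j0))/GU].
    by split; split=> // e; [move: ii; rewrite e ltnn|move: jj; rewrite e ltnn].
  have th1 i1 j0 j1 : (j1 < j0)%N -> theta P X1 X2 (a 0%N) (s1 i1) (s2 j0) (s2 j1).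
    move=> jj; apply: (avg_inst (Y := fun x => theta P X1 X2 x (s1 i1) (s2 j0) (s2 j1))
      (k := i1.+1) s1F (aM 0%N)); last by move=> i /th0; apply.
    have [|Pd' X1d' X2d'] := PE (E `|` initial a 0%N); first by move=> c /EB; left.
    have := @theta_definable W1 W2 P X1 X2 (W1 * 'I_n) _ inl (inr \o s1 i1)
      (inr \o s2 j0) (inr \o s2 j1) Pd' X1d' X2d'.
    apply=> // w c [<-]; left; first by left; right; exists i1, w.
      by right; exists j0, w.
    by right; exists j1, w.
  have th2 j0 j1 : (j1 < j0)%N -> theta P X1 X2 (a 0%N) (a 1%N) (s2 j0) (s2 j1).
    move=> jj; apply: (avg_inst (Y := fun x => theta P X1 X2 (a 0%N) x (s2 j0) (s2 j1))
      (k := 0%N) s1F (aM 1%N)); last by move=> i _; exact: th1.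
    have [|Pd' X1d' X2d'] := PE (E `|` initial a 1%N); first by move=> c /EB; left.
    have := @theta_definable W1 W2 P X1 X2 (W1 * 'I_n) _ (inr \o a 0%N) inl
      (inr \o s2 j0) (inr \o s2 j1) Pd' X1d' X2d'.
    apply=> // w c [<-]; first by right; exists 0%N, w.
      by left; right; exists j0, w.
    by left; right; exists j1, w.
  have th3 j1 : theta P X1 X2 (a 0%N) (a 1%N) (b 0%N) (s2 j1).
    apply: (avg_inst (Y := fun y => theta P X1 X2 (a 0%N) (a 1%N) y (s2 j1))
      (k := j1.+1) s2F (bM 0%N)); last by move=> i /th2.
    have [|Pd' X1d' X2d'] := PE (E `|` entries a `|` initial b 0%N).
      by move=> c /EB; left; left.
    have := @theta_definable W1 W2 P X1 X2 (W2 * 'I_n) _ (inr \o a 0%N) (inr \o a 1%N)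
      inl (inr \o s2 j1) Pd' X1d' X2d'.
    apply=> // w c [<-]; left; first by right; exists 0%N, w.
      by right; exists 1%N, w.
    by left; right; exists j1, w.
  apply: (avg_inst (Y := fun y => theta P X1 X2 (a 0%N) (a 1%N) (b 0%N) y)
    (k := 0%N) s2F (bM 1%N)); last by move=> i _; exact: th3.
  have [|Pd' X1d' X2d'] := PE (E `|` entries a `|` initial b 1%N).
    by move=> c /EB; left; left.
  have := @theta_definable W1 W2 P X1 X2 (W2 * 'I_n) _ (inr \o a 0%N) (inr \o a 1%N)
    (inr \o b 0%N) inl Pd' X1d' X2d'.
  apply=> // w c [<-]; first by left; right; exists 0%N, w.
    by left; right; exists 1%N, w.
  by right; exists 0%N, w.
pose E' := B `|` (entries a `|` entries b).
have E's : small K E' by do 2?[apply: small_setU => //]; exact: small_entries.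
have fiber_def (W : finType) X (x : W * 'I_n -> C) : definable B X -> range x `<=` E' ->
    gdef D E' [set g : unit -> gT | fiber X x (pt D (g tt))].
  move=> Xd xE'; pose h (i : 'I_n) : unit * 'I_n + C := inl (tt, i).
  exists [set e | fiber X (cat_env e id \o (inr \o x)) (cat_env e id \o h)].
    apply: definable_fiber => //; first by apply: definable_sub Xd => c; left.
    by move=> w c [<-]; apply: xE'; exists w.
  by [].
(* Separating points exist in every definable neighborhood of [G], hence in [G]. *)
have [|||| g [Gg gP]] := @gsat_td _ _ _ _ D K sat_C unit B E' G (fun _ => [set g |
    (fiber X1 (a 0%N) (pt D (g tt)) /\ ~ fiber X1 (a 1%N) (pt D (g tt))) /\
    (fiber X2 (b 0%N) (pt D (g tt)) /\ ~ fiber X2 (b 1%N) (pt D (g tt)))])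
    E's _ B_base G_td.
- by move=> c; left.
- have aE' k : range (a k) `<=` E' by move=> _ [w _ <-]; right; left; exists k, w.
  have bE' k : range (b k) `<=` E' by move=> _ [w _ <-]; right; right; exists k, w.
  move=> _; apply: gdefI; apply: gdefI; try apply: gdefC; exact: fiber_def.
- by move=> k l _ g.
- by move=> U _ /theta_ab[g [Ug gab]]; exists (fun=> g).
have {gP}[[ga0 ga1] [gb0 gb1]] := gP 0%N.
have [|] := dp_min infinite_nat infinite_nat ab_indisc (Gg tt).
  by move=> /(fiber_indiscernible X1d) /(_ ga0).
by move=> /(fiber_indiscernible X2d) /(_ gb0).
Qed.
End Grid.

(** * Subgroups, conjugation and commuting elements *)

Section GroupFacts.
Variable gT : groupType.
Implicit Types x y z : gT.

Lemma subgroup1 (H : set gT) : Defs.subgroup H -> H 1.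
Proof. by case; rewrite inE. Qed.

Lemma subgroupV (H : set gT) x : Defs.subgroup H -> H x -> H x^-1.
Proof. by move=> /group_closedV HV /mem_set/HV; rewrite inE. Qed.

Lemma subgroupM (H : set gT) x y : Defs.subgroup H -> H x -> H y -> H (x * y).
Proof. by move=> /group_closedM HM /mem_set Hx /mem_set/(HM _ _ Hx); rewrite inE. Qed.

Lemma subgroupX (H : set gT) x k : Defs.subgroup H -> H x -> H (x ^+ k).
Proof.
move=> Hg Hx; elim: k => [|k IHk]; first exact: subgroup1.
by rewrite expgS; exact: subgroupM.
Qed.

Lemma subgroupJ (H : set gT) x y : Defs.subgroup H -> H x -> H y -> H (x ^ y).
Proof.
by move=> Hg Hx Hy; apply: subgroupM => //; [exact: subgroupV|exact: subgroupM].
Qed.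

Lemma subgroupP (H : set gT) : H 1 -> (forall x y, H x -> H y -> H (x * y)) ->
  (forall x, H x -> H x^-1) -> Defs.subgroup H.
Proof.
move=> H1 HM HV; split; first by rewrite inE.
by move=> x y; rewrite !inE => Hx Hy; apply: HM => //; exact: HV.
Qed.

Lemma conjg_eq x y z : x ^ y = x ^ z <-> commute x (y / z).
Proof.
split=> [xyz|xyz].
  by apply/commgP; apply/conjg_fixP; rewrite conjgM xyz conjgK.
apply: (@conjg_inj _ z^-1); rewrite conjgK -conjgM.
by apply/conjg_fixP/commgP.
Qed.

Lemma commute_divX x y i j : (forall r, ~ commute x (y ^+ r.+1)) ->
  commute x (y ^+ i / y ^+ j) -> i = j.
Proof.
move=> xy; wlog : i j / (j <= i)%N => [wlg|ji].
  have [ji|/ltnW ij] := leqP j i; first exact: wlg.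
  move=> /commuteV; rewrite invgF => ?; apply/esym; exact: wlg.
rewrite -expgnFr//; case e : (i - j)%N => [|r] xr; last by case: (xy r).
by apply/eqP; rewrite eqn_leq ji andbT -subn_eq0 e.
Qed.

End GroupFacts.

(** * Commuting powers in a dp-minimal group *)

Section Powers.
Variables (L : language) (C : structure L) (K : Type) (gT : groupType) (n : nat).
Hypotheses (sat_C : saturated K C) (K_limit : strong_limit K).
Hypothesis nat_small : small K [set: nat].
Variables (D : definable_group C gT n) (G : set gT) (B : set C).
Hypotheses (B_small : small K B) (B_base : gbase D B) (G_td : gtd D B G).
Hypothesis G_subgroup : Defs.subgroup G.
Hypothesis dp_min : dp_minimal_over D G B.

(** If no bound worked, compactness would give [x] and [y] in [G] such that no positive power of
    either commutes with the other, and the products [x ^+ i * y ^+ j] would form a forbidden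
    grid. *)
Lemma dp_minimal_commute : exists m, (0 < m)%N /\
  forall x y, G x -> G y -> commute (x ^+ m) y \/ commute x (y ^+ m).
Proof.
pose S k (r : 'I_k) : set (bool -> gT) := [set g |
  ~ g true ^+ r.+1 * g false = g false * g true ^+ r.+1 /\
  ~ g true * g false ^+ r.+1 = g false ^+ r.+1 * g true].
have [[k kP]|nk] := EM (exists k, forall g : bool -> gT, G (g true) -> G (g false) ->
    ~ (forall r : 'I_k, S k r g)).
  (* The factorial is a multiple of every exponent [r.+1] with [r < k]. *)
  exists k`!; split; first exact: fact_gt0.
  move=> x y Gx Gy; have := kP (fun b => if b then x else y) Gx Gy.
  move=> /existsNP[r /not_andP nS].
  have [d rd] : exists d, k`! = (r.+1 * d)%N.
    have /dvdnP[d ->] : (r.+1 %| k`!)%N by apply: dvdn_fact; rewrite /= ltn_ord.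
    by exists d; rewrite mulnC.
  rewrite rd !expgnA; case: nS => /contrapT xy; [left|right].
    by apply/commute_sym/commuteX/commute_sym.
  exact: commuteX.
exfalso; have [|||| g [Gg gP]] := @gsat_td _ _ _ _ D K sat_C bool B B G
  (fun k => [set g | forall r : 'I_k, S k r g]) B_small _ B_base G_td.
- by [].
- move=> k; apply: gdef_forall => r; apply: gdefI; apply: gdefC; apply: gdef_eq => //;
    apply: gfun_mul => //; try apply: gfun_exp => //; exact: gfun_proj.
- by move=> k l kl g gS r; exact: (gS (widen_ord kl r)).
- move=> U k [_ GU]; apply: contrapT => no; apply: nk; exists k => g gt gf gS.
  by apply: no; exists g; split => // -[]; exact: GU.
set x := g true in gP; set y := g false in gP.
have xy r : ~ commute y (x ^+ r.+1).
  by move=> /commute_sym; have [] := gP r.+1 ord_max.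
have yx r : ~ commute x (y ^+ r.+1) by have [] := gP r.+1 ord_max.
(* Rows are the left cosets of the centralizer of [y] by powers of [x], columns the right cosets of
   the centralizer of [x] by powers of [y]. Both are recognized by conjugates, and [commute_divX]
   shows them to be distinct. *)
pose u (a b : gT) (c : bool) := if c then a else b.
apply: (@dp_minimal_grid _ _ _ _ _ sat_C K_limit nat_small D G B B_small B_base G_td
  dp_min bool bool (fun i => u (x ^+ i) y) (fun j => u (y ^+ j) x)
  (fun i j => x ^+ i * y ^+ j)
  [set h | h (Some false) ^ (h None)^-1 = h (Some false) ^ (h (Some true))^-1]
  [set h | h (Some false) ^ h None = h (Some false) ^ h (Some true)]).
- by apply: gdef_eq => //; apply: gfun_conj => //; try apply: gfun_inv => //;
    exact: gfun_proj.
- by apply: gdef_eq => //; apply: gfun_conj => //; exact: gfun_proj.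
- by move=> i j; apply: subgroupM; rewrite // ; apply: subgroupX => //; exact: Gg.
- move=> i j i' /=; rewrite invgM conjgM (_ : y ^ (y ^+ j)^-1 = y); last first.
    by apply/conjg_fixP/commgP; apply: commuteV; exact: commuteX.
  rewrite conjg_eq; split=> [xii|->]; last by rewrite mulgV; exact: commute1.
  apply/esym; apply: commute_divX xy _.
  have -> : x ^+ i' / x ^+ i = (x ^+ i)^-1 * x ^+ i'.
    by apply: commuteV; exact: commuteX2.
  by rewrite invgK in xii.
- move=> i j j' /=; rewrite conjgM (_ : x ^ (x ^+ i) = x); last first.
    by apply/conjg_fixP/commgP; exact: commuteX.
  rewrite conjg_eq; split=> [|->]; last by rewrite mulgV; exact: commute1.
  exact: commute_divX yx.
Qed.

End Powers.

(** * The global type *)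

Section PowerFormula.
Variables (L : language) (C : structure L) (gT : groupType) (n : nat).
Variable D : definable_group C gT n.

Definition conj_formula V (s : seq (formula L V)) : formula L V :=
  foldr (@And L V) (Imp Bot Bot) s.

Lemma sat_conj (N : structure L) V (T : finType) (phi : T -> formula L V) (e : V -> N) :
  sat (conj_formula [seq phi i | i <- enum T]) e <-> forall i, sat (phi i) e.
Proof.
suff H s : sat (conj_formula [seq phi i | i <- s]) e <->
    forall i, i \in s -> sat (phi i) e.
  by rewrite H; split=> [all i|all i _]; apply: all; rewrite ?mem_enum.
elim: s => [|i s IHs]; first by split=> // _ [].
have -> : conj_formula [seq phi i | i <- i :: s] =
  And (phi i) (conj_formula [seq phi i | i <- s]) by [].
rewrite sat_And IHs; split=> [[pi ps] j|all].
  by rewrite inE => /orP[/eqP->|/ps].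
split=> [|j js]; first exact/all/mem_head.
by apply: all; rewrite inE js orbT.
Qed.

(** Expresses [is_power] by a formula in [x] and [y], uniformly in the extension, so that
    completeness of [q] can be applied to it. *)
Fixpoint power_formula k : formula L ('I_n + 'I_n + C) :=
  if k is k'.+1 then ExN (And
    (rename (fun u : 'I_n + 'I_n + C => match u with
      | inl (inl i) => inl (inl (inl i))
      | inl (inr i) => inr i
      | inr c => inl (inr c)
      end) (power_formula k'))
    (rename (fun u : 'I_n + 'I_n + 'I_n + C => match u with
      | inl (inl (inl i)) => inr i
      | inl (inl (inr i)) => inl (inl (inl i))
      | inl (inr i) => inl (inl (inr i))
      | inr c => inl (inr c)
      end) (Defs.mul D)))
  else conj_formula [seq Eq (Var L (inl (inr i))) (Var L (inr (pt D 1 i)))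
                    | i <- enum 'I_n].

Lemma sat_power (N : structure L) (j : C -> N) (x : 'I_n -> N) k y :
  sat (power_formula k) (cat_env (cat_env x y) j) <-> is_power D j x k y.
Proof.
elim: k y => [|k IHk] y /=.
  by rewrite sat_conj /=; split=> [yE|-> //]; apply/funext => i; exact: yE.
rewrite sat_ExN; split=> [[z /sat_And[]]|[z zk zy]].
  rewrite !sat_rename => zk zy; exists z.
    apply/IHk; move: zk; congr (sat _ _); by apply/funext => -[[]|].
  by move: zy; congr (sat _ _); apply/funext => -[[[]|]|].
exists z; apply/sat_And; rewrite !sat_rename; split.
  move/IHk: zk; congr (sat _ _); by apply/funext => -[[]|].
by move: zy; congr (sat _ _); apply/funext => -[[[]|]|].
Qed.

Lemma is_power_pt g k : is_power D id (pt D g) k (pt D (g ^+ k)).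
Proof.
elim: k => [|k IHk] //=; exists (pt D (g ^+ k)) => //.
by apply/mulP; exists (g ^+ k), g; rewrite expgSr.
Qed.

End PowerFormula.

Section GlobalType.
Variables (L : language) (C : structure L) (K : Type) (gT : groupType) (n : nat).
Hypotheses (sat_C : saturated K C) (K_limit : strong_limit K).
Hypothesis L_small : small K [set: formula L nat].
Variables (D : definable_group C gT n) (G00 : set gT) (q : set (formula L ('I_n + C))).
Hypotheses (q_type : global_type q) (q_conc : concentrated_on K q (pt D @` G00)).

(* [X] belongs to [q], for a set [X] of points of the group. *)
Definition holds (X : set gT) :=
  exists2 phi, q phi & forall g, sat phi (cat_env (pt D g) id) -> X g.

Lemma q_consistent phi psi : q phi -> q psi ->
  exists x, sat phi (cat_env x id) /\ sat psi (cat_env x id).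
Proof.
move=> qphi qpsi; have [||x xp] := q_type.1 [set phi; psi].
- exact: finite_set2.
- by move=> _ [->|->].
by exists x; split; apply: xp; [left|right].
Qed.

Lemma q_And phi psi : q phi -> q psi -> q (And phi psi).
Proof.
move=> qphi qpsi; have [//|qn] := q_type.2 (And phi psi).
have [||x xp] := q_type.1 [set phi; psi; Neg (And phi psi)].
- exact: finite_set3.
- by move=> _ [[->|->]|->].
exfalso; apply: (xp (Neg (And phi psi))); first by right.
by apply/sat_And; split; apply: xp; left; [left|right].
Qed.

Lemma holdsS X Y : X `<=` Y -> holds X -> holds Y.
Proof. by move=> XY [phi qphi phiX]; exists phi => // g /phiX/XY. Qed.

Lemma holdsI X Y : holds X -> holds Y -> holds (X `&` Y).
Proof.
move=> [phi qphi phiX] [psi qpsi psiY]; exists (And phi psi); first exact: q_And.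
by move=> g /sat_And[/phiX ? /psiY].
Qed.

Lemma gdef1_formula E (X : set gT) : gdef1 D E X ->
  exists2 phi : formula L ('I_n + C), Defs.over E phi &
    forall g, sat phi (cat_env (pt D g) id) <-> X g.
Proof.
move=> [Y Yd XY]; have [phi phiE YE] := definable_reindex (@snd unit 'I_n) Yd.
exists phi => // g; have -> : X g <-> Y (flat D (fun=> g)) := XY (fun=> g).
by change ([set z | sat phi (cat_env z id)] (pt D g) <-> Y (flat D (fun=> g))); rewrite -YE.
Qed.

Lemma holds_complete E (X : set gT) : gdef1 D E X -> holds X \/ holds (~` X).
Proof.
move=> /gdef1_formula[phi _ phiX]; have [qphi|qn] := q_type.2 phi; [left|right].
  by exists phi => // g /phiX.
by exists (Neg phi) => // g np /phiX.
Qed.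

(** Concentration is a statement about realizations in extensions. As [q] has such a realization, it
    cannot contain the negation of a formula of [p], and it is complete. *)
Lemma q_support : exists A (p : set (formula L ('I_n + C))),
  [/\ small K A, forall phi, p phi -> Defs.over A phi,
      pt D @` G00 = realizations p & p `<=` q].
Proof.
have [A [p [As pA pE pq]]] := q_conc; exists A, p; split => // phi pphi.
have [//|qn] := q_type.2 phi.
have [N [j [x [jel xq]]]] := global_type_realized q_type.1.
by have := xq _ qn; case; exact: pq jel xq _ pphi.
Qed.

Lemma realize_restriction E : small K E ->
  exists2 b, G00 b & forall phi, q phi -> Defs.over E phi -> sat phi (cat_env (pt D b) id).
Proof.
move=> Es; have [A [p [As pA pE pq]]] := q_support.
have nat_small := nat_small_of_language L_small.
have [|||x xq] := sat_C (A := A `|` E) (p := restriction q (A `|` E)).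
- exact: small_setU.
- by move=> phi [].
- move=> p0 p0f p0q; apply: q_type.1 => //.
  by move=> phi /p0q[].
have [b Gb bx] : (pt D @` G00) x.
  by rewrite pE => phi pphi; apply: xq; split; [exact: pq|move=> c /(pA _ pphi); left].
by exists b => // phi qphi phiE; rewrite bx; apply: xq; split=> // c /phiE; right.
Qed.

Lemma q_dom : q (dom D).
Proof.
have [//|qn] := q_type.2 (dom D).
have [|b _ bq] := realize_restriction (E := [set c | fv (dom D) (inr c)]).
  apply: small_le (nat_small_of_language L_small); apply: finite_set_countable.
  by apply: finite_preimage (fv_finite (dom D)) => ? ? _ _ [].
have : ~ sat (dom D) (cat_env (pt D b) id).
  by apply: (bq (Neg (dom D)) qn) => c /fv_Neg.
by case; apply/domP; exists b.
Qed.

Lemma holds_ne X : holds X -> X !=set0.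
Proof.
move=> [phi qphi phiX]; have [x [/domP[g <-] gphi]] := q_consistent q_dom qphi.
by exists g; exact: phiX.
Qed.

(** [holds] only provides some formula of [q] implying [X]. By completeness and consistency, a
    formula over [E] that defines [X] is itself in [q]. *)
Lemma holds_formula E X : gdef1 D E X -> holds X -> exists2 phi,
  Defs.over E phi /\ q phi & forall g, sat phi (cat_env (pt D g) id) <-> X g.
Proof.
move=> Xd qX; have [phi phiE phiX] := gdef1_formula Xd; exists phi => //; split=> //.
have [//|qn] := q_type.2 phi.
have [|g [Xg]] := holds_ne (holdsI qX (_ : holds (~` X))); last by [].
by exists (Neg phi) => // g np /phiX.
Qed.

Lemma realize_q E : small K E ->
  exists2 b, G00 b & forall X, gdef1 D E X -> holds X -> X b.
Proof.
move=> Es; have [b Gb bq] := realize_restriction Es; exists b => // X Xd qX.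
by have [phi [phiE qphi] <-] := holds_formula Xd qX; exact: bq.
Qed.

Lemma holds_nontorsion k : non_torsion_type D q -> (0 < k)%N ->
  holds [set x | x ^+ k <> 1].
Proof.
move=> q_nt k_gt0.
pose phi : formula L ('I_n + C) := rename (fun u : 'I_n + 'I_n + C => match u with
  | inl (inl i) => inl i | inl (inr i) => inr (pt D 1 i) | inr c => inr c end)
  (power_formula D k).
have satE (N : structure L) (j : C -> N) x :
    sat phi (cat_env x j) <-> is_power D j x k (j \o pt D 1).
  rewrite sat_rename -sat_power.
  rewrite (_ : _ \o _ = cat_env (cat_env x (j \o pt D 1)) j) //.
  by apply/funext => -[[]|].
have [qphi|qn] := q_type.2 phi.
  have [N [j [x [jel xq]]]] := global_type_realized q_type.1.
  by have := q_nt N j x jel xq k k_gt0; case; apply/satE; exact: xq.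
exists (Neg phi) => // g /= np gk; apply: np; apply/satE.
by have := is_power_pt D g k; rewrite gk.
Qed.

End GlobalType.

(** * Generic subgroups have small index *)

(** The parameters are pulled back to the submodel, where the existential statement that [X] is
    nonempty holds by elementarity. *)
Lemma elementary_submodel_meets L (M : structure L) (N0 : set M) n (X : set ('I_n -> M)) :
  elementary_submodel N0 -> definable N0 X -> X !=set0 ->
  exists2 a, X a & forall i, N0 (a i).
Proof.
move=> [N [j [jel N0E]]] [phi phiN0 ->] [x xphi].
have [jV jVP] : {jV : M -> N & forall c, N0 c -> j (jV c) = c}.
  apply: (@choice _ _ (fun c b => N0 c -> j b = c)) => c.
  have [b0] := carrier_inhabited N; rewrite N0E.
  by have [[b _ bc]|nc] := EM (range j c); [exists b|exists b0].
pose psi := rename (fun u : 'I_n + M => match u with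
  | inl i => inr i | inr c => inl (jV c) end) phi.
have satE (y : 'I_n -> M) : sat psi (cat_env j y) <-> sat phi (cat_env y id).
  by rewrite sat_rename; apply sat_eq_fv => -[//|c] /= /phiN0 /jVP ->.
have /jel/sat_ExN[y psiy] : sat (ExN psi) j by apply/sat_ExN; exists x; exact/satE.
exists (j \o y); last by move=> i; rewrite N0E; exists (y i).
apply/satE; pose sub (u : N + 'I_n) : N := match u with inl b => b | inr i => y i end.
have : sat (rename sub psi) id.
  by rewrite sat_rename; move: psiy; congr (sat psi _); apply/funext => -[].
rewrite jel sat_rename; congr (sat psi _).
by apply/funext => -[].
Qed.

Section Coheir.
Variables (L : language) (C : structure L) (N0 : set C) (n : nat).
Hypothesis N0_sub : elementary_submodel N0.

(** The type of [x] over [N0] is finitely satisfiable in [N0], so it extends to an ultrafilter on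
    tuples from [N0]. *)
Lemma coheir_ex (x : 'I_n -> C) : exists F : set_system ('I_n -> C),
  [/\ UltraFilter F, F [set c | forall i, N0 (c i)] &
      forall E a, N0 `<=` E -> avg E F a -> same_type N0 x a].
Proof.
pose F0 : set_system ('I_n -> C) := [set S | exists X, [/\ definable N0 X, X x &
  forall c, X c -> (forall i, N0 (c i)) -> S c]].
have F0F : ProperFilter F0.
  apply: Build_ProperFilter_ex.
    move=> S [X [Xd Xx XS]].
    have [|a Xa aN0] := elementary_submodel_meets N0_sub Xd; first by exists x.
    by exists a; exact: XS.
  split.
  - by exists setT; split => //; exact: definableT.
  - move=> S S' [X [Xd Xx XS]] [Y [Yd Yx YS']]; exists (X `&` Y); split => //.
      exact: definableI.
    by move=> c [Xc Yc] cN0; split; [exact: XS|exact: YS'].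
  - move=> S S' SS' [X [Xd Xx XS]]; exists X; split => // c Xc cN0.
    exact/SS'/XS.
have [F [FU F0F']] := ultraFilterLemma F0F; exists F; split => //.
  by apply: F0F'; exists setT; split => //; exact: definableT.
move=> E a N0E aF; apply: same_typeP => X Xd Xx.
apply: aF; first exact: definable_sub Xd.
by apply: F0F'; exists X.
Qed.

End Coheir.

Section Index.
Variables (L : language) (C : structure L) (K : Type) (gT : groupType) (n : nat).
Hypotheses (sat_C : saturated K C) (K_limit : strong_limit K).
Hypothesis L_small : small K [set: formula L nat].
Variables (D : definable_group C gT n) (G G00 : set gT) (q : set (formula L ('I_n + C))).
Hypotheses (q_type : global_type q) (q_conc : concentrated_on K q (pt D @` G00)).
Hypothesis q_generic : forall A, small K A -> left_f_generic K D G (restriction q A).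

Let nat_small := nat_small_of_language L_small.

Lemma gdef_same_type V A (R : set (V -> gT)) g h : gdef D A R ->
  same_type A (flat D g) (flat D h) -> R g -> R h.
Proof. by move=> [X Xd RX] gh; rewrite !RX => /(same_type_def gh Xd). Qed.

(* The values of [type_code N0] are sets over a visibly small type. *)
Definition type_code (N0 : set C) (x : 'I_n -> C) : set (formula L nat * seq N0) :=
  [set phis | forall d, sat phis.1 (fun i => if insub i is Some i' then x i'
     else nth d (map val phis.2) (i - n))].

Arguments type_code : clear implicits.

Lemma type_code_same_type (N0 : set C) x y d : N0 d ->
  type_code N0 x = type_code N0 y -> same_type N0 x y.
Proof.
move=> N0d xy; apply: same_typeP => X Xd.
have [k [b [psi [bN0 ->]]]] := definable_params N0d Xd.
(* Variables below [n] stand for the tuple and those from [n] on for the listed parameters, as in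
   [type_code]. *)
pose phi := rename (fun u : 'I_n + 'I_k => match u with
  | inl i => i : nat | inr i => (n + i)%N end) psi.
pose s : seq N0 := [seq SigSub (mem_set (bN0 i)) | i <- enum 'I_k].
have satE (z : 'I_n -> C) : type_code N0 z (phi, s) <-> sat psi (cat_env z b).
  have E d' : sat phi (fun i => if insub i is Some i' then z i'
      else nth d' (map val s) (i - n)) <-> sat psi (cat_env z b).
    rewrite sat_rename; rewrite (_ : _ \o _ = cat_env z b) //.
    apply/funext => -[i|i] /=; first by rewrite valK.
    rewrite insubF; last by rewrite ltnNge leq_addr.
    by rewrite addKn -map_comp (nth_map i) ?size_enum_ord// nth_ord_enum.
  by split=> [/(_ d)/E|zb d']; [|exact/E].
by move=> /satE; rewrite xy => /satE.
Qed.

Lemma coset_eq (H : set gT) h h' : Defs.subgroup H -> H (h^-1 * h') ->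
  [set h * x | x in H] = [set h' * x | x in H].
Proof.
move=> Hg hh'; apply/seteqP; split=> _ [x Hx <-].
  exists ((h^-1 * h')^-1 * x); last by rewrite invgM invgK !mulgA mulgV mul1g.
  by apply: subgroupM => //; exact: subgroupV.
by exists (h^-1 * h' * x); [exact: subgroupM|rewrite !mulgA mulgV mul1g].
Qed.

(** The coset of [h] is determined by the type of [h] over [N0], and types are bounded by their
    codes. *)
Lemma small_cosets_same_type (H : set gT) N0 d : small K N0 -> N0 d ->
  Defs.subgroup H ->
  (forall h h', G h -> G h' -> same_type N0 (pt D h) (pt D h') -> H (h^-1 * h')) ->
  small K (cosets G H).
Proof.
move=> N0s N0d Hg H_type.
pose coset_of_code T : set gT := [set x | exists h, [/\ G h,
  type_code N0 (pt D h) = T & [set h * x | x in H] x]].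
have code_small : small K [set: set (formula L nat * seq N0)].
  by apply: smallT_pow => //; apply: smallT_prod => //; apply: smallT_seq => //; exact: smallT_set.
apply: small_sub (small_image coset_of_code code_small).
move=> _ [h Gh <-]; exists (type_code N0 (pt D h)) => //.
apply/seteqP; split=> x; last by move=> hx; exists h.
move=> [h' [Gh' /(type_code_same_type N0d) h'h]].
by rewrite (@coset_eq H h' h) //; exact: H_type.
Qed.

Section Divides.
Variables (N0 : set C) (d : C).
Hypotheses (N0_small : small K N0) (N0_sub : elementary_submodel N0) (N0d : N0 d).
Hypothesis N0_base : gbase D N0.

(** The translates of [U] by the [a i] are pairwise disjoint: [a i * x = a j * y] with [x] and [y]
    in [U] would put [(a i)^-1 * a j] in [W]. *)
Lemma divides_translate (U W : set gT) h (a : nat -> gT) :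
  gdef1 D N0 U -> (forall x y, U x -> U y -> W (x * y^-1)) ->
  (forall i, same_type N0 (pt D (a i)) (pt D h)) ->
  (forall i j, (i < j)%N -> ~ W ((a i)^-1 * a j)) ->
  divides N0 [set pt D (h * x) | x in U].
Proof.
move=> Ud UW ah aW.
have Rd : gdef D N0 [set g : bool -> gT | U ((g false)^-1 * g true)].
  by apply: gdef_app => //; apply: gfun_mul => //; [apply: gfun_inv => //|];
    exact: gfun_proj.
have [X Xd RX] := Rd.
pose f (vi : bool * 'I_n) : 'I_n + 'I_n := if vi.1 then inl vi.2 else inr vi.2.
have Yd : definable N0 ([set z : 'I_n + 'I_n -> C | sat (dom D) (cat_env (z \o inl) id)] `&`
    [set z : 'I_n + 'I_n -> C | X (z \o f)]).
  apply: definableI (definable_reindex f Xd).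
  exact: (definable_reindex inl N0_base.1).
have [k [b0 [psi [b0N0 YE]]]] := definable_params N0d Yd.
have psiE x g : sat psi (cat_env (cat_env x (pt D g)) b0) <->
    exists2 y, x = pt D (g * y) & U y.
  have -> : sat psi (cat_env (cat_env x (pt D g)) b0) <->
      [set x | sat psi (cat_env x b0)] (cat_env x (pt D g)) by [].
  rewrite -YE /=; split=> [[/domP[y yx]]|[y -> Uy]].
    have {yx} <- : pt D y = x by rewrite yx; apply/funext.
    have <- : flat D (fun b => if b then y else g) = cat_env (pt D y) (pt D g) \o f.
      by apply/funext => -[[] i].
    by move=> /RX/= Uy; exists (g^-1 * y) => //; rewrite mulgA mulgV mul1g.
  split; first by apply/domP; exists (g * y).
  have <- : flat D (fun b => if b then g * y else g) = cat_env (pt D (g * y)) (pt D g) \o f.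
    by apply/funext => -[[] i].
  by apply/RX; rewrite /= mulgA mulVg mul1g.
(* The translating element and the parameters in [N0] are merged into one tuple; only the first part
   varies along the sequence. *)
pose psi' : formula L ('I_n + 'I_(n + k)) := rename (fun u : ('I_n + 'I_n) + 'I_k =>
  match u with
  | inl (inl i) => inl i
  | inl (inr i) => inr (lshift k i)
  | inr i => inr (rshift n i)
  end) psi.
pose b g (i : 'I_(n + k)) : C := match fintype.split i with inl i => pt D g i | inr i => b0 i end.
have psi'E x g : sat psi' (cat_env x (b g)) <-> exists2 y, x = pt D (g * y) & U y.
  rewrite -psiE sat_rename; move: (psi).
  have -> : cat_env (cat_env x (pt D g)) b0 = cat_env x (b g) \o
      (fun u : ('I_n + 'I_n) + 'I_k => match u with
        | inl (inl i) => inl i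
        | inl (inr i) => inr (lshift k i)
        | inr i => inr (rshift n i)
        end).
    apply/funext => -[[i|i]|i] //=; rewrite /b.
      by rewrite (unsplitK (inl i)).
    by rewrite (unsplitK (inr i)).
  by [].
exists (n + k)%N, psi', (b h); split.
  apply/seteqP; split=> x.
    by move=> [y Uy <-]; apply/psi'E; exists y.
  by move=> /psi'E[y -> Uy]; exists y.
exists 2%N, (fun i => b (a i)); split.
  move=> i; pose fb (i : 'I_(n + k)) : 'I_n + C :=
    match fintype.split i with inl i => inl i | inr i => inr (b0 i) end.
  have bE g : b g = cat_env (pt D g) id \o fb.
    by apply/funext => j; rewrite /b /fb /=; case: (fintype.split j).
  apply: same_typeP => Y Yd'; rewrite !bE.
  apply (same_type_def (ah i) (X := [set e | Y (cat_env e id \o fb)])).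
  apply: definable_subst Yd' => v c; rewrite /fb; case: (fintype.split v) => // j [<-].
  exact: b0N0.
move=> s s_inj [x xP].
have [y0 xy0 Uy0] := (psi'E _ _).1 (xP ord0).
have [y1 xy1 Uy1] := (psi'E _ _).1 (xP ord_max).
have ayE : a (s ord0) * y0 = a (s ord_max) * y1.
  by apply: (@pt_inj _ _ _ _ D); rewrite -xy0 -xy1.
have no i j z w : (i < j)%N -> a i * z = a j * w -> U z -> U w -> False.
  move=> ij zw Uz Uw; apply: (aW i j ij).
  suff -> : (a i)^-1 * a j = z * w^-1 by exact: UW.
  by apply: (mulIg w); rewrite mulgVK -mulgA -zw mulgA mulVg mul1g.
have [ij|ji|ij] := ltngtP (s ord0) (s ord_max).
- exact: no ij ayE Uy0 Uy1.
- exact: no ji (esym ayE) Uy1 Uy0.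
- by have /s_inj := ij.
Qed.

Lemma nbhd_pair_same_type W x y x' y' : gdef1 D N0 W ->
  same_type N0 (cat_env (pt D x) (pt D y)) (cat_env (pt D x') (pt D y')) ->
  W (x^-1 * y) -> W (x'^-1 * y').
Proof.
move=> Wd xy; pose u (z w : gT) (b : bool) := if b then z else w.
pose f (vi : bool * 'I_n) : 'I_n + 'I_n := if vi.1 then inl vi.2 else inr vi.2.
have uE z w : flat D (u z w) = cat_env (pt D z) (pt D w) \o f.
  by apply/funext => -[[] i].
have := @gdef_same_type bool N0 [set g | W ((g true)^-1 * g false)] (u x y) (u x' y').
apply; last by rewrite !uE; exact: same_type_reindex.
by apply: gdef_app => //; apply: gfun_mul => //; [apply: gfun_inv => //|];
  exact: gfun_proj.
Qed.

(** Otherwise a Morley sequence of a coheir of the type of [h] runs through distinct cosets of [H].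
    Then the translate by [h] of a definable neighborhood of [H] divides over [N0], although [q]
    contains that neighborhood and is generic. *)
Lemma coset_same_type (H : set gT) h h' :
  gtd D N0 G -> gtd D N0 H -> Defs.subgroup H ->
  (forall U, nbhd D N0 H U -> holds D q U) ->
  G h -> same_type N0 (pt D h) (pt D h') -> H (h^-1 * h').
Proof.
move=> Gtd Htd Hg qH Gh hh'; apply: contrapT => nH.
have [F [FU FN0 Fh]] := coheir_ex N0_sub (pt D h).
have [a aM] := morley_ex sat_C K_limit nat_small _ N0_small (F := F).
have ha i : same_type N0 (pt D h) (a i) by apply: Fh (aM i) => c; left.
have pt_type x : same_type N0 (pt D h) x -> exists g, pt D g = x.
  by move=> hx; apply/domP; apply (same_type_def hx N0_base.1); apply/domP; exists h.
have [al alE] := choice (fun i => pt_type _ (ha i)).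
have pair_al i j : (i < j)%N -> same_type N0
    (cat_env (pt D (al i)) (pt D (al j))) (cat_env (pt D (al 0%N)) (pt D (al 1%N))).
  move=> ij; rewrite !alE; apply: (avg_same_type FU FN0).
  - exact: same_type_trans (same_type_sym (ha i)) (ha 0%N).
  - apply: avg_sub (aM j); apply: setUS => _ [v _ <-]; by exists i, v.
  - apply: avg_sub (aM 1%N); apply: setUS => _ [v _ <-]; by exists 0%N, v.
have range_small (V : finType) (x : V -> C) : small K (range x).
  exact: small_countable.
have [|c cF] := avg_ex sat_C _ (F := F)
  (E := N0 `|` (range (pt D h) `|` range (pt D h'))).
  by do 2?[apply: small_setU => //]; exact: range_small.
have [ga gaE] : exists g, pt D g = c by apply/pt_type/(Fh _ _ _ cF) => x; left.
have pair_h x : same_type N0 (pt D h) (pt D x) -> range (pt D x) `<=`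
    range (pt D h) `|` range (pt D h') -> same_type N0
    (cat_env (pt D (al 0%N)) (pt D (al 1%N))) (cat_env (pt D x) (pt D ga)).
  move=> hx xhh'; rewrite !alE gaE; apply: (avg_same_type FU FN0).
  - exact: same_type_trans (same_type_sym (ha 0%N)) hx.
  - apply: avg_sub (aM 1%N); apply: setUS => _ [v _ <-]; by exists 0%N, v.
  - by apply: avg_sub cF; exact: setUS.
(* If two terms shared a coset, then [h] and [h'] would both share one with the average [ga] taken
   over them, and hence with each other. *)
have nH01 : ~ H ((al 0%N)^-1 * al 1%N).
  move=> H01; apply: nH.
  have H_ga x : same_type N0 (pt D h) (pt D x) -> range (pt D x) `<=`
      range (pt D h) `|` range (pt D h') -> H (x^-1 * ga).
    move=> hx xhh'; apply: Htd => W [Wd HW].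
    exact: nbhd_pair_same_type Wd (pair_h x hx xhh') (HW _ H01).
  have -> : h^-1 * h' = (h^-1 * ga) * (h'^-1 * ga)^-1.
    by rewrite invgM invgK mulgA mulgK.
  apply: subgroupM => //; first by apply: H_ga => // x; left.
  by apply: subgroupV => //; apply: H_ga => // x; right.
have [W [Wd HW] nW] : exists2 W, nbhd D N0 H W & ~ W ((al 0%N)^-1 * al 1%N).
  apply: contrapT => no; apply: nH01; apply: Htd => W HW.
  by apply: contrapT => nW; apply: no; exists W.
(* As [H] is a group, some neighborhood [U] has all its quotients in [W]. *)
have [|||U [Ud HU] UW] := @nbhd_shrink _ _ _ _ D K sat_C bool N0 N0 H
    [set g | W (g true * (g false)^-1)] N0_small _ N0_base Htd _.
- by [].
- by apply: gdef_app => //; apply: gfun_mul => //; [|apply: gfun_inv => //];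
    exact: gfun_proj.
- by move=> g gH; apply: HW; apply: subgroupM => //; exact: subgroupV.
have : divides N0 [set pt D (h * x) | x in U].
  apply: (divides_translate (W := W) (a := al)) => //.
  - by move=> x y Ux Uy; apply: (UW (fun b => if b then x else y)); case.
  - by move=> i; rewrite alE; exact: same_type_sym.
  - move=> i j /pair_al/(nbhd_pair_same_type Wd) Wij /Wij; exact: nW.
move=> U_divides.
have GN0 : group_over D N0 G.
  by case: N0_base => dN0 mN0; split=> //; exact: gtd_type_definable.
have qN0 : type_definable N0 (realizations (restriction q N0)).
  by exists (restriction q N0) => // phi [].
apply: (q_generic N0_small N0_small N0_sub GN0 qN0 Gh).
exists 1%N, (fun=> [set pt D (h * x) | x in U]); split=> //.
move=> _ [x [Gx xq] <-]; exists ord0, x => //.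
have [phi [phiN0 qphi] <-] := holds_formula sat_C K_limit L_small q_type q_conc Ud
  (qH U (conj Ud HU)).
exact: xq.
Qed.

End Divides.

Lemma generic_small_index A (H : set gT) :
  small K A -> gbase D A -> gtd D A G -> gtd D A H -> Defs.subgroup H ->
  (forall U E, small K E -> nbhd D E H U -> holds D q U) -> small K (cosets G H).
Proof.
move=> As A_base Gtd Htd Hg qH.
have [N0 [N0s N0e AN0]] := small_elementary_submodel K_limit L_small As.
have [d N0d] : N0 !=set0.
  by have [N [j [_ ->]]] := N0e; have [b] := carrier_inhabited N; exists (j b), b.
apply: (small_cosets_same_type N0s N0d Hg) => h h' Gh _.
apply: (coset_same_type N0s N0e N0d) => //; [|exact: gtd_sub AN0 Gtd|exact: gtd_sub AN0 Htd|].
  exact: gbase_sub AN0 A_base.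
by move=> U; exact: qH.
Qed.

End Index.

(** * Groups of class two *)

Section Centralizer.
Variable gT : groupType.
Implicit Types (x y z : gT) (H V : set gT).

Definition centralizer H : set gT := [set e | forall h, H h -> commute e h].

Definition nontorsion x := forall k, (0 < k)%N -> x ^+ k <> 1.

Lemma centralizer_subgroup H : Defs.subgroup (centralizer H).
Proof.
apply: subgroupP => [h _|x y xH yH h Hh|x xH h Hh].
- exact/commute_sym/commute1.
- by apply/commute_sym/commuteM; apply/commute_sym; [exact: xH|exact: yH].
- by apply/commute_sym/commuteV/commute_sym/xH.
Qed.

Lemma centralizerJ H e x : Defs.subgroup H -> centralizer H e -> H x ->
  centralizer H (e ^ x).
Proof.
by move=> Hg eH Hx; rewrite (_ : e ^ x = e) //; apply/conjg_fixP/commgP/eH.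
Qed.

Lemma divJg a b y : (a^-1 * b) ^ y = (a ^ y)^-1 * b ^ y.
Proof. by rewrite conjMg conjVg. Qed.

Lemma commg_centralizer_subgroup H g : Defs.subgroup H -> H g ->
  Defs.subgroup [set x | H x /\ centralizer H [~ g, x]].
Proof.
move=> Hg Hgg; have ZH := centralizer_subgroup H.
apply: subgroupP => [|x y [Hx gx] [Hy gy]|x [Hx gx]].
- by rewrite /= commg1; split; exact: subgroup1.
- split; first exact: subgroupM.
  have -> : [~ g, x * y] = [~ g, y] * [~ g, x] ^ y.
    by rewrite !commgEl conjgM (divJg g (g ^ x)) -[RHS]mulgA mulVKg.
  exact: subgroupM ZH gy (centralizerJ Hg gx Hy).
- split; first exact: subgroupV.
  have -> : [~ g, x^-1] = ([~ g, x] ^ x^-1)^-1.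
    by rewrite !commgEl (divJg g (g ^ x)) conjgK invgM invgK.
  by apply: (subgroupV ZH); apply: centralizerJ => //; exact: subgroupV.
Qed.

Lemma gen_subgroup_subgroup V : Defs.subgroup (gen_subgroup V).
Proof.
apply: subgroupP => [H Hg _|x y Vx Vy H Hg VH|x Vx H Hg VH].
- exact: subgroup1.
- by apply: subgroupM => //; [exact: Vx|exact: Vy].
- by apply: subgroupV => //; exact: Vx.
Qed.

Lemma sub_gen V : V `<=` gen_subgroup V.
Proof. by move=> x Vx H _; apply. Qed.

Lemma gen_min V H : Defs.subgroup H -> V `<=` H -> gen_subgroup V `<=` H.
Proof. by move=> Hg VH x; apply. Qed.

(** Centrality of commutators passes from generators to the group one entry at a time: first the
    third, then the second, then the first, each time because the good elements form a subgroup. *)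
Lemma gen_class2 V :
  (forall x y z, V x -> V y -> V z -> commute [~ x, y] z) ->
  nilpotent_class_le 2 (gen_subgroup V).
Proof.
move=> V2; set H := gen_subgroup V.
have Hg : Defs.subgroup H by exact: gen_subgroup_subgroup.
have VH : V `<=` H by exact: sub_gen.
have VZ x y : V x -> V y -> centralizer H [~ x, y].
  move=> Vx Vy h Hh.
  have cg := centralizer_subgroup [set [~ x, y]].
  apply/commute_sym; apply: (gen_min cg _ Hh) => // z Vz _ ->.
  exact/commute_sym/V2.
have inv x y : centralizer H [~ x, y] -> centralizer H [~ y, x].
  by move=> xy; rewrite -invgR; apply: (subgroupV (@centralizer_subgroup H)).
have VHZ x y : V x -> H y -> centralizer H [~ x, y].
  move=> Vx Hy; have := gen_min (commg_centralizer_subgroup Hg (VH _ Vx)).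
  by move=> /(_ V) sub; case: (sub _ y Hy) => // z Vz; split; [exact: VH|exact: VZ].
have HHZ x y : H x -> H y -> centralizer H [~ x, y].
  move=> Hx Hy; have := gen_min (commg_centralizer_subgroup Hg Hx).
  move=> /(_ V) sub; case: (sub _ y Hy) => // z Vz; split; first exact: VH.
  by apply: inv; exact: VHZ.
have LC1 : lower_central H 1 `<=` centralizer H.
  apply: gen_min; first exact: centralizer_subgroup.
  by move=> _ [x Hx [y Hy <-]]; exact: HHZ.
apply: gen_min.
  by apply: subgroupP => [//|x y -> ->|x ->]; rewrite /= ?mulg1 ?invg1.
move=> _ [x /LC1 xZ [y Hy <-]] /=.
by apply/eqP/commgP/xZ.
Qed.

Lemma nontorsionX x m : (0 < m)%N -> nontorsion x -> nontorsion (x ^+ m).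
Proof. by move=> m_gt0 xn k k_gt0; rewrite -expgnA; apply: xn; rewrite muln_gt0 m_gt0. Qed.

Lemma nontorsion_inj x i j : nontorsion x -> x ^+ i = x ^+ j -> i = j.
Proof.
move=> xn; wlog : i j / (j <= i)%N => [wlg|ji xij].
  have [ji|/ltnW ij] := leqP j i; first exact: wlg.
  by move=> /esym xji; apply/esym; exact: wlg.
have : x ^+ (i - j) = 1 by rewrite expgnFr// xij mulgV.
case e : (i - j)%N => [|r] xr; last by have := xn r.+1 isT.
by apply/eqP; rewrite eqn_leq ji andbT -subn_eq0 e.
Qed.

(* If [g ^ u = g * zeta] with [zeta] central, then [(g ^+ m) ^ (u ^+ m)] is
   [g ^+ m * zeta ^+ (m * m)], so commuting [m]-th powers make [zeta] torsion. *)
Lemma commuting_powers_inj g x c z m i j : (0 < m)%N -> nontorsion z ->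
  commute g z -> commute x z -> commute c z ->
  commute (g ^+ m) ((x * c^-1) ^+ m) ->
  g ^ x * z ^+ i = g ^ c * z ^+ j -> i = j.
Proof.
move=> m_gt0 zn gz xz cz; set u := x * c^-1 => gu gxc.
pose zeta := z ^+ j / z ^+ i.
have zeta_comm y : commute y z -> commute y zeta.
  by move=> yz; apply: commuteM; [exact: commuteX|apply: commuteV; exact: commuteX].
have uz : commute u z.
  by apply/commute_sym/commuteM; [exact/commute_sym|apply: commuteV; exact/commute_sym].
have fix_u y : commute y u -> y ^ u = y by move=> /commgP/conjg_fixP.
have gu1 : g ^ u = g * zeta.
  have cVz k : (z ^+ k) ^ c^-1 = z ^+ k.
    apply/conjg_fixP/commgP; apply: commuteV; apply/commute_sym.
    exact: commuteX.
  have := congr1 (conjg^~ c^-1) gxc.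
  rewrite /= (conjMg (g ^ x)) (conjMg (g ^ c)) !cVz conjgK -conjgM => e.
  by rewrite /zeta mulgA -e mulgK.
have gu_pow l : g ^ (u ^+ l) = g * zeta ^+ l.
  elim: l => [|l IHl]; first by rewrite conjg1 mulg1.
  rewrite expgSr conjgM IHl conjMg gu1 (fix_u (zeta ^+ l)); last first.
    by apply/commute_sym; apply: commuteX; exact: zeta_comm.
  by rewrite expgS (mulgA g zeta).
have : (g ^+ m) ^ (u ^+ m) = g ^+ m by apply/conjg_fixP/commgP.
rewrite conjXg gu_pow expgMn; last by apply: commuteX; exact: zeta_comm.
rewrite -[RHS]mulg1 => /mulgI; rewrite -expgnA /zeta expgnFl; last exact: commuteX2.
move=> /divg1_eq; rewrite -!expgnA => /(nontorsion_inj zn)/eqP.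
by rewrite eqn_pmul2r ?muln_gt0 ?m_gt0// => /eqP.
Qed.

End Centralizer.

(** * The main argument *)

Section Main.
Variables (L : language) (C : structure L) (K : Type) (gT : groupType) (n : nat).
Hypotheses (sat_C : saturated K C) (K_limit : strong_limit K).
Hypothesis L_small : small K [set: formula L nat].
Variables (D : definable_group C gT n) (G G00 : set gT) (q : set (formula L ('I_n + C))).
Hypotheses (q_type : global_type q) (q_conc : concentrated_on K q (pt D @` G00)).
Hypothesis q_generic : forall A, small K A -> left_f_generic K D G (restriction q A).
Hypothesis q_nontorsion : non_torsion_type D q.
Hypotheses (G_subgroup : Defs.subgroup G) (G00_subgroup : Defs.subgroup G00).
Hypothesis G00_sub : G00 `<=` G.
Hypothesis G00_index : small K (cosets G G00).
Hypothesis G00_min : forall H E, small K E -> gbase D E -> gtd D E H ->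
  Defs.subgroup H -> H `<=` G -> small K (cosets G H) -> G00 `<=` H.
Variables (A : set C).
Hypotheses (A_small : small K A) (A_base : gbase D A).
Hypotheses (G_td : gtd D A G) (G00_td : gtd D A G00).
Variable m : nat.
Hypotheses (m_gt0 : (0 < m)%N).
Hypothesis G_commute : forall x y, G x -> G y ->
  commute (x ^+ m) y \/ commute x (y ^+ m).

Let nat_small := nat_small_of_language L_small.

Definition pts (S : set gT) : set C := [set c | exists2 s, S s & exists i, pt D s i = c].

Lemma small_pts S : small K S -> small K (pts S).
Proof.
move=> Ss; pose f (si : S * 'I_n) := pt D (val si.1) si.2.
apply: (@small_sub _ _ _ (range f)).
  by move=> c [s Ss' [i <-]]; exists (SigSub (mem_set Ss'), i).
apply: small_image; apply: smallT_prod => //; first exact: smallT_set.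
apply: (smallT_inj (f := @nat_of_ord n)) nat_small; exact: val_inj.
Qed.

Lemma small_finite T (S : set T) : finite_set S -> small K S.
Proof. by move=> /finite_set_countable SN; exact: small_le SN nat_small. Qed.

Definition with_pts (S : set gT) : set C := A `|` pts S.

Lemma with_pts_base S : gbase D (with_pts S).
Proof. by apply: gbase_sub A_base => c; left. Qed.

Lemma with_pts_small S : small K S -> small K (with_pts S).
Proof. by move=> Ss; apply: small_setU => //; exact: small_pts. Qed.

Lemma gfun_pts V (S : set gT) c : S c -> gfun D (with_pts S) (fun _ : V -> gT => c).
Proof.
move=> Sc; apply: gfun_const; first exact: with_pts_base.
by move=> i; right; exists c => //; exists i.
Qed.

Lemma gdef_commute V E (s t : (V -> gT) -> gT) : gbase D E ->
  gfun D E s -> gfun D E t -> gdef D E [set g | commute (s g) (t g)].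
Proof. by move=> Eb sf tf; apply: gdef_eq => //; exact: gfun_mul. Qed.

Lemma nbhd_with_pts H S U : nbhd D A H U -> nbhd D (with_pts S) H U.
Proof. by move=> [Ud HU]; split=> //; apply: gdef_sub Ud => c; left. Qed.

(** A realization of [q] over enough parameters lies in [H], so [q] contains every neighborhood of
    [H]; then [H] has small index, and minimality of [G00] applies. *)
Lemma G00_contained (H S : set gT) : small K S -> gtd D (with_pts S) H ->
  Defs.subgroup H -> H `<=` G ->
  (forall b, G00 b -> (forall X, gdef1 D (with_pts S) X -> holds D q X -> X b) -> H b) ->
  G00 `<=` H.
Proof.
move=> Ss Htd Hg HG Hb; have Es := with_pts_small Ss.
apply: (G00_min Es (with_pts_base S)) => //.
apply: (generic_small_index sat_C K_limit L_small q_type q_conc q_generic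
  Es (with_pts_base S) _ Htd Hg).
  by apply: gtd_sub G_td => c; left.
move=> U E' E's [Ud HU].
have [//|nU] := holds_complete q_type Ud; exfalso.
have [b Gb bq] := realize_q sat_C K_limit L_small q_type q_conc (small_setU K_limit nat_small Es E's).
have : ~ U b.
  apply: (bq (~` U)) => //; apply: gdefC.
  by apply: gdef_sub Ud => c; right.
apply; apply/HU/Hb => // X Xd; apply: bq.
by apply: gdef_sub Xd => c; left.
Qed.

Lemma centralizer_holds e : holds D q [set x | commute x e] -> centralizer G00 e.
Proof.
move=> qe; pose S := [set e]; have Ss : small K S by exact/small_finite/finite_set1.
have ed : gdef1 D (with_pts S) [set x | commute x e].
  have Eb := with_pts_base S.
  by apply: gdef_commute => //; [exact: gfun_proj|exact: gfun_pts].
pose H := [set x | G x /\ commute x e].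
suff : G00 `<=` H by move=> sub y /sub[_ /commute_sym].
apply: (G00_contained Ss).
- move=> x xU; split.
    by apply: G_td => U /(nbhd_with_pts S)[Ud GU]; apply: xU; split=> // y [/GU].
  by apply: (xU [set x | commute x e]); split=> // y [].
- apply: subgroupP => [|x y [Gx xe] [Gy ye]|x [Gx xe]].
  + by split; [exact: subgroup1|exact/commute_sym/commute1].
  + split; first exact: subgroupM.
    by apply/commute_sym/commuteM; exact/commute_sym.
  + split; first exact: subgroupV.
    by apply/commute_sym; apply: commuteV; exact/commute_sym.
- by move=> x [].
- by move=> b /G00_sub Gb bq; split=> //; exact: (bq [set x | commute x e]).
Qed.

Lemma realize_nontorsion S : small K S -> exists b, [/\ G00 b, nontorsion b &
  forall X, gdef1 D (with_pts S) X -> holds D q X -> X b].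
Proof.
move=> Ss; have [b Gb bq] := realize_q sat_C K_limit L_small q_type q_conc (with_pts_small Ss).
exists b; split => // k k_gt0; apply: (bq [set x | x ^+ k <> 1]); last first.
  exact: holds_nontorsion.
have Eb := with_pts_base S.
apply: gdefC; apply: gdef_eq => //; last exact: gfun_one.
by apply: gfun_exp => //; exact: gfun_proj.
Qed.

Definition commutes_generic : set gT :=
  [set g | G g /\ holds D q [set x | commute (x ^+ m) g]].

Lemma power_commute_def S g : S g -> gdef1 D (with_pts S) [set x | commute (x ^+ m) g].
Proof.
move=> Sg; have Eb := with_pts_base S; apply: gdef_commute => //.
  by apply: gfun_exp => //; exact: gfun_proj.
exact: gfun_pts.
Qed.

(** Let [b] realize [q] over [g]. Either [b ^+ m] commutes with [g], or [b] commutes with [g ^+ m],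
    and then [centralizer_holds] applies. *)
Lemma commutes_generic_or g : G g ->
  commutes_generic g \/ centralizer G00 (g ^+ m).
Proof.
move=> Gg; pose S := [set g; g ^+ m]; have Ss : small K S by exact/small_finite/finite_set2.
have Eb := with_pts_base S.
have d1 := @power_commute_def S g (or_introl erefl).
have d2 : gdef1 D (with_pts S) [set x | commute x (g ^+ m)].
  apply: gdef_commute => //; first exact: gfun_proj.
  by apply: gfun_pts; right.
have [qg|nqg] := holds_complete q_type d1; first by left.
have [qgm|nqgm] := holds_complete q_type d2; first by right; exact: centralizer_holds.
have [b [Gb _ bq]] := realize_nontorsion Ss.
have b1 := bq _ (gdefC d1) nqg; have b2 := bq _ (gdefC d2) nqgm.
by have [] := G_commute (G00_sub Gb) Gg.
Qed.

Lemma commutes_generic_subgroup : Defs.subgroup commutes_generic.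
Proof.
have q1 : holds D q setT by exists (dom D) => //; exact: (q_dom sat_C K_limit L_small q_type q_conc).
apply: subgroupP => [|x y [Gx qx] [Gy qy]|x [Gx qx]].
- split; first exact: subgroup1.
  by apply: holdsS q1 => x _; exact: commute1.
- split; first exact: subgroupM.
  by apply: holdsS (holdsI q_type qx qy) => z [zx zy]; exact: commuteM.
- by split; [exact: subgroupV|apply: holdsS qx => z; exact: commuteV].
Qed.

(* This description does not mention [q], so that [commutes_generic] is
   type-definable. *)
Lemma commutes_generic_nontorsion h :
  ~ (exists z, [/\ G z, nontorsion z & centralizer G00 z]) ->
  commutes_generic h <-> G h /\ exists y, [/\ G y, nontorsion y & commute y h].
Proof.
move=> bad; have nt_generic g : G g -> nontorsion g -> commutes_generic g.
  move=> Gg gnt; have [//|gm] := commutes_generic_or Gg; case: bad.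
  by exists (g ^+ m); split => //; [exact: subgroupX|exact: nontorsionX].
split=> [[Gh qh]|[Gh [y [Gy ynt yh]]]].
  split=> //; have Ss : small K [set h] by exact/small_finite/finite_set1.
  have [b [Gb bnt bq]] := realize_nontorsion Ss; exists (b ^+ m); split.
  - by apply: subgroupX => //; exact: G00_sub.
  - exact: nontorsionX.
  - by apply: (bq _ _ qh); exact: power_commute_def.
(* Elements of [G] outside [commutes_generic] are torsion. With [h] outside and [y] inside, [h * y]
   is outside; since [h] and [y] commute and both [h] and [h * y] are torsion, [y] would be
   torsion. *)
apply: contrapT => nh.
have tors g : G g -> ~ commutes_generic g -> exists2 k, (0 < k)%N & g ^+ k = 1.
  move=> Gg ng; apply: contrapT => no; apply: ng; apply: nt_generic => // k k_gt0 gk.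
  by apply: no; exists k.
have [k k_gt0 hk] := tors h Gh nh.
have [||l l_gt0 hyl] := tors (h * y).
- exact: subgroupM.
- move=> hy; apply: nh; rewrite -(mulgK y h).
  have Xg := commutes_generic_subgroup.
  by apply: (subgroupM Xg hy); apply: (subgroupV Xg); exact: nt_generic.
apply: (ynt (k * l)%N); first by rewrite muln_gt0 k_gt0.
have : (h * y) ^+ (k * l) = 1 by rewrite mulnC expgnA hyl expg1n.
rewrite expgMn; last exact/commute_sym.
by rewrite [h ^+ _]expgnA hk expg1n mul1g.
Qed.

(** If no non-torsion element of [G] centralizes [G00], then [commutes_generic] is type-definable
    and contains [G00], and [z] is the [m]-th power of a realization of [q] over [S]. *)
Lemma central_nontorsion S : S `<=` G00 -> small K S ->
  exists z, [/\ G z, nontorsion z & forall s, S s -> commute z s].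
Proof.
move=> SG00 Ss.
have [[z [Gz znt zG00]]|bad] := EM (exists z, [/\ G z, nontorsion z & centralizer G00 z]).
  by exists z; split => // s /SG00; exact: zG00.
have G00_generic : G00 `<=` commutes_generic.
  have Xg := commutes_generic_subgroup.
  have empty_small : small K (@set0 gT) by exact/small_finite/finite_set0.
  apply: (G00_contained empty_small) => //; last first.
  - move=> b Gb bq; apply/(commutes_generic_nontorsion _ bad).
    split; first exact: G00_sub.
    exists b; split => //; first exact: G00_sub.
    move=> k k_gt0; apply: (bq [set x | x ^+ k <> 1]); last exact: holds_nontorsion.
    have Eb := with_pts_base set0.
    apply: gdefC; apply: gdef_eq => //; last exact: gfun_one.
    by apply: gfun_exp => //; exact: gfun_proj.
  - by move=> x [].
  have -> : commutes_generic = [set h | G h /\ exists y, [/\ G y, nontorsion y & commute y h]].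
    by apply/seteqP; split=> h /(commutes_generic_nontorsion _ bad).
  apply: (@gtd_sub _ _ _ _ D A); first by move=> c; left.
  move=> h hU; split.
    by apply: G_td => U [Ud GU]; apply: hU; split=> // y [/GU].
  have Hs : small K [set h] by exact/small_finite/finite_set1.
  have Eb := with_pts_base [set h].
  have powd E (V : Type) v k : gbase D E ->
      gdef D E [set g : V -> gT | forall r : 'I_k, g v ^+ r.+1 <> 1].
    move=> E'b; apply: gdef_forall => r; apply: gdefC; apply: gdef_eq => //; last exact: gfun_one.
    by apply: gfun_exp => //; exact: gfun_proj.
  (* For each [k] and each neighborhood [U] of [G], commuting with some [y] in [U] whose first [k]
     positive powers are nontrivial is a definable condition over [A], so it holds of [h];
     compactness then gives one non-torsion [y] in [G]. *)
  have [||||g [Gg gP]] := @gsat_td _ _ _ _ D K sat_C unit A (with_pts [set h]) G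
    (fun k => [set g | (forall r : 'I_k, g tt ^+ r.+1 <> 1) /\ commute (g tt) h])
    (with_pts_small Hs) _ A_base G_td.
  - by move=> c; left.
  - move=> k; apply: gdefI; first exact: powd.
    by apply: gdef_commute => //; [exact: gfun_proj|exact: gfun_pts].
  - by move=> k l kl g [gl gh]; split => // r; exact: (gl (widen_ord kl r)).
  - move=> U k [Ud GU].
    suff [y [Uy yk yh]] : [set h | exists y, [/\ U y, forall r : 'I_k, y ^+ r.+1 <> 1 &
        commute y h]] h by exists (fun=> y).
    apply: hU; split; last first.
      move=> x [Gx [y [Gy ynt yx]]]; exists y; split => //; first exact: GU.
      by move=> r; exact: ynt.
    have : gdef D A [set g : option unit -> gT | U (g None) /\
        ((forall r : 'I_k, g None ^+ r.+1 <> 1) /\ commute (g None) (g (Some tt)))].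
      apply: gdefI; first by apply: gdef_app => //; exact: gfun_proj.
      apply: gdefI; first exact: powd.
      by apply: gdef_commute => //; exact: gfun_proj.
    move=> /(gdef_ex A_base (R := fun g y => U y /\
        ((forall r : 'I_k, y ^+ r.+1 <> 1) /\ commute y (g tt)))).
    by apply: gdef_iff => g /=; split=> -[y]; [move=> [Uy [yr yg]]|move=> [Uy yr yg]]; exists y.
  exists (g tt); split => //; last by case: (gP 0%N).
  by move=> [//|k] _; have [gk _] := gP k.+1; exact: (gk ord_max).
have [b [Gb bnt bq]] := realize_nontorsion Ss; exists (b ^+ m); split.
- by apply: subgroupX => //; exact: G00_sub.
- exact: nontorsionX.
move=> s Ss'; have [_ qs] := G00_generic s (SG00 s Ss').
by apply: (bq _ _ qs); exact: power_commute_def.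
Qed.

(** * Conjugates modulo the centralizer of [G00], and the conclusion *)

Variable B : set C.
Hypotheses (B_small : small K B) (B_base : gbase D B) (GB_td : gtd D B G).
Hypothesis dp_min : dp_minimal_over D G B.

(** The columns of the next grid quantify over a conjugating element, which has to range over a
    definable set instead of [G]. *)
Lemma commuting_powers_nbhd : exists2 U, nbhd D B G U &
  forall g x c, U g -> U x -> U c -> commute (g ^+ m) ((x * c^-1) ^+ m).
Proof.
have [|||U GU UP] := @nbhd_shrink _ _ _ _ D K sat_C (option bool) B B G
  [set h | commute (h None ^+ m) ((h (Some true) * (h (Some false))^-1) ^+ m)]
  B_small _ B_base GB_td _.
- by [].
- apply: gdef_commute => //; apply: gfun_exp => //; first exact: gfun_proj.
  by apply: gfun_mul => //; [|apply: gfun_inv => //]; exact: gfun_proj.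
- move=> h hG; have Gu : G (h (Some true) * (h (Some false))^-1).
    by apply: subgroupM => //; exact: subgroupV.
  have [gu|gu] := G_commute (hG None) Gu; first exact: commuteX.
  exact/commute_sym/commuteX/commute_sym.
exists U => // g x c Ug Ux Uc.
by apply: (UP (fun o => if o is Some b then if b then x else c else g)) => -[[]|].
Qed.

(** Otherwise the elements [g ^ x i * z ^+ j] form a forbidden grid, where [z] commutes with [g],
    with all [x i], and with a realization [w] of [q]. *)
Lemma conjugates_finite g (x : nat -> gT) : G00 g -> (forall i, G00 (x i)) ->
  exists i j, (i < j)%N /\ centralizer G00 ((g ^ x i)^-1 * g ^ x j).
Proof.
move=> Gg Gx; apply: contrapT => no.
have nij i j : i <> j -> ~ centralizer G00 ((g ^ x i)^-1 * g ^ x j).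
  move=> ij Zij; have [lt|gt|//] := ltngtP i j; first by apply: no; exists i, j.
  apply: no; exists j, i; split => //.
  rewrite -[X in _ (_ * X)]invgK -invgM.
  exact: (subgroupV (@centralizer_subgroup _ _)).
pose S : set gT := range (fun ij : nat * nat => (g ^ x ij.1)^-1 * g ^ x ij.2).
have Ss : small K S by exact: small_countable.
have [w [Gw _ wq]] := realize_nontorsion Ss.
(* If [q] implied commuting with this quotient, the quotient would centralize [G00]. *)
have wij i j : i <> j -> ~ commute w ((g ^ x i)^-1 * g ^ x j).
  move=> ij; pose e := (g ^ x i)^-1 * g ^ x j.
  have Eb := with_pts_base S.
  have ed : gdef1 D (with_pts S) [set y | commute y e].
    apply: gdef_commute => //; first exact: gfun_proj.
    by apply: gfun_pts; exists (i, j).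
  have [qe|nqe] := holds_complete q_type ed; first by case: (nij i j ij); exact: centralizer_holds.
  exact: wq (gdefC ed) nqe.
have [||z [Gz znt zS]] := @central_nontorsion ([set g; w] `|` range x).
- by move=> _ [[->|->]|[i _ <-]].
- apply: small_setU => //; first exact/small_finite/finite_set2.
  exact: small_countable.
have zg : commute z g by apply: zS; left; left.
have zw : commute z w by apply: zS; left; right.
have zx i : commute z (x i) by apply: zS; right; exists i.
have [U [Ud GU] UP] := commuting_powers_nbhd.
(* Rows are cosets of the centralizer of [w]. Column [j] consists of the [g ^ c * z ^+ j] with [c]
   in [U] commuting with [z]; columns are disjoint by [commuting_powers_inj]. *)
pose u1 i (b : bool) := if b then g ^ x i else w.
pose u2 j (o : option bool) := if o is Some b then if b then g else z else z ^+ j.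
apply: (@dp_minimal_grid _ _ _ _ _ sat_C K_limit nat_small D G B B_small B_base GB_td
  dp_min bool (option bool) u1 u2 (fun i j => g ^ x i * z ^+ j)
  [set h | h (Some false) ^ (h None)^-1 = h (Some false) ^ (h (Some true))^-1]
  [set h | exists c, U c /\ (c * h (Some (Some false)) = h (Some (Some false)) * c /\
      h None = h (Some (Some true)) ^ c * h (Some None))]).
- by apply: gdef_eq => //; apply: gfun_conj => //; try apply: gfun_inv => //;
    exact: gfun_proj.
- apply: (gdef_ex B_base (R := fun h c => U c /\
      (c * h (Some (Some false)) = h (Some (Some false)) * c /\
      h None = h (Some (Some true)) ^ c * h (Some None)))).
  apply: gdefI; first by apply: gdef_app => //; exact: gfun_proj.
  apply: gdefI; apply: gdef_eq => //; try apply: gfun_mul => //; try exact: gfun_proj.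
  by apply: gfun_conj => //; exact: gfun_proj.
- move=> i j; apply: subgroupM => //; last exact: subgroupX.
  by apply: subgroupJ => //; exact: G00_sub.
- move=> i j i' /=; rewrite invgM conjgM (_ : w ^ (z ^+ j)^-1 = w); last first.
    by apply/conjg_fixP/commgP; apply: commuteV; apply: commuteX; exact/commute_sym.
  rewrite conjg_eq invgK; split=> [wii|->]; last by rewrite mulVg; exact: commute1.
  by apply: contrapT => /wij; apply.
- move=> i j j' /=; split=> [[c [Uc [cz vE]]]|->].
    apply: (commuting_powers_inj m_gt0 znt _ _ cz _ vE).
    + exact/commute_sym.
    + exact/commute_sym.
    + by apply: UP => //; apply: GU; exact: G00_sub.
  by exists (x i); split; [exact/GU/G00_sub|split=> //; exact/commute_sym].
Qed.

Definition same_conj g x y := centralizer G00 ((g ^ x)^-1 * g ^ y).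

(** Representatives are picked greedily, which stops by [conjugates_finite]. The default of [nth]
    adds the representative [1] at index [size s]; a listed element equivalent to [1] must be
    [1]. *)
Lemma conjugates_cover g : G00 g -> exists s : seq gT,
  [/\ forall i, G00 (nth 1 s i), forall i, same_conj g (nth 1 s i) 1 -> nth 1 s i = 1 &
      forall y, G00 y -> exists i : 'I_(size s).+1, same_conj g (nth 1 s i) y].
Proof.
move=> Gg; apply: contrapT => no.
pose good (s : seq gT) := (forall i, G00 (nth 1 s i)) /\
  (forall i, same_conj g (nth 1 s i) 1 -> nth 1 s i = 1).
have ZG := @centralizer_subgroup _ G00.
have sym x y : same_conj g x y -> same_conj g y x.
  by move=> xy; rewrite /same_conj -[X in _ (_ * X)]invgK -invgM; exact: (subgroupV ZG).
have next s : exists y, good s -> G00 y /\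
    forall i : 'I_(size s).+1, ~ same_conj g (nth 1 s i) y.
  have [sg|] := EM (good s); last by exists 1.
  apply: contrapT => noy; apply: no; exists s; split; try by case: sg.
  move=> y Gy; apply: contrapT => nsy; apply: noy; exists y => _; split => // i siy.
  by apply: nsy; exists i.
have [f fP] := choice next.
pose s := fix s k := if k is k'.+1 then rcons (s k') (f (s k')) else [::].
have s_size k : size (s k) = k by elim: k => //= k IHk; rewrite size_rcons IHk.
have s_nth k i : nth 1 (s k) i = if (i < k)%N then f (s i) else 1.
  elim: k => [|k IHk] /=; first by rewrite nth_nil.
  rewrite nth_rcons s_size IHk ltnS (leq_eqVlt i k).
  by case: (ltngtP i k) => [//|//|->].
have s_good k : good (s k).
  elim: k => [|k IHk]; first by split=> i; rewrite nth_nil //; exact: subgroup1.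
  have [Gf fn] := fP _ IHk; split=> i.
    have := IHk.1 i; rewrite !s_nth ltnS (leq_eqVlt i k).
    by case: (ltngtP i k) => [//|//|->].
  have := IHk.2 i; rewrite !s_nth ltnS (leq_eqVlt i k).
  case: (ltngtP i k) => [//|//|->] _ fk1.
  by case: (fn ord_max); rewrite s_size /= s_nth ltnn; exact: sym.
have [i [j [ij]]] := conjugates_finite Gg (fun k => (fP _ (s_good k)).1).
have i_lt : (i < (size (s j)).+1)%N by rewrite s_size ltnS ltnW.
by have := (fP _ (s_good j)).2 (Ordinal i_lt); rewrite /= s_nth ij.
Qed.

Lemma centralizer_nbhd e : centralizer G00 e ->
  exists2 U, nbhd D A G00 U & forall w, U w -> commute e w.
Proof.
move=> Ze; have es : small K [set e] by exact/small_finite/finite_set1.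
have Eb := with_pts_base [set e].
have [|||U GU UP] := @nbhd_shrink _ _ _ _ D K sat_C unit A (with_pts [set e]) G00
  [set w | commute e (w tt)] (with_pts_small es) _ A_base G00_td _.
- by move=> c; left.
- by apply: gdef_commute => //; [exact: gfun_pts|exact: gfun_proj].
- by move=> w wG; exact: Ze.
by exists U => // w Uw; exact: (UP (fun=> w)).
Qed.

(* [C(G00)] is a union of the definable sets [C(U)] for definable [U] containing
   [G00]; since finitely many cosets of the stabilizer of [g] modulo [C(G00)]
   cover [G00], a single [U] suffices. *)
Lemma conjugates_cover_nbhd g : G00 g -> exists (s : seq gT) U,
  [/\ nbhd D A G00 U, forall i, G00 (nth 1 s i),
      forall i, same_conj g (nth 1 s i) 1 -> nth 1 s i = 1 &
      forall y, G00 y -> exists i : 'I_(size s).+1,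
        forall w, U w -> commute ((g ^ nth 1 s i)^-1 * g ^ y) w].
Proof.
move=> Gg; have [s [Gs s1 cover]] := conjugates_cover Gg; exists s.
pose R U : set (unit -> gT) := [set y | U (y tt) /\ forall i : 'I_(size s).+1,
  ~ forall w, U w -> commute ((g ^ nth 1 s i)^-1 * g ^ y tt) w].
have [[U [GU RU0]]|] := EM (exists U, nbhd D A G00 U /\ ~ (R U !=set0)).
  exists U; split=> // y Gy; apply: contrapT => no; apply: RU0.
  exists (fun=> y); split; first exact: GU.2.
  by move=> i iw; apply: no; exists i.
move=> noU; exfalso.
pose S := [set g] `|` range (nth 1 s).
have Ss : small K S.
  apply: small_setU => //; last exact: small_countable.
  exact/small_finite/finite_set1.
have Eb := with_pts_base S.
have [||||y yP] := @gsat _ _ _ _ D K sat_C unit (set gT) (nbhd D A G00) R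
  (with_pts S) (with_pts_small Ss) Eb.
- by exists setT; exact: nbhdT.
- move=> U /(nbhd_with_pts S)[Ud _]; apply: gdefI; first by apply: gdef_app => //; exact: gfun_proj.
  apply: gdef_forall => i; apply: gdefC.
  apply: (@gdef_iff _ _ _ _ _ _ _ [set y | ~ exists w, U w /\
      ~ commute ((g ^ nth 1 s i)^-1 * g ^ y tt) w]).
    move=> y /=; split=> [no w Uw|all [w [Uw]]]; last by case; exact: all.
    by apply: contrapT => nc; apply: no; exists w.
  apply: gdefC; apply: (gdef_ex Eb (R := fun y w => U w /\
      ~ commute ((g ^ nth 1 s i)^-1 * g ^ y tt) w)).
  apply: gdefI; first by apply: gdef_app => //; exact: gfun_proj.
  apply: gdefC; apply: gdef_commute => //; last exact: gfun_proj.
  apply: gfun_mul => //.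
    apply: gfun_inv => //; apply: gfun_conj => //; apply: gfun_pts; first by left.
    by right; exists i.
  apply: gfun_conj => //; last exact: gfun_proj.
  by apply: gfun_pts; left.
- move=> U W GU GW; exists (U `&` W); first exact: nbhdI.
  move=> y [[Uy Wy] no].
  by split; split=> // i all; apply: (no i) => w [Uw Ww]; apply: all.
- by move=> U GU; apply: contrapT => RU0; apply: noU; exists U.
have Gy : G00 (y tt) by apply: G00_td => U GU; case: (yP U GU).
have [i /centralizer_nbhd[U GU UP]] := cover _ Gy.
by have [_ /(_ i)] := yP U GU; apply.
Qed.

(** The good [x] form a subgroup [P] of [G00], with finitely many cosets there by the cover and
    type-definable by [PU]; minimality of [G00] gives equality. *)
Lemma commutator_central g x : G00 g -> G00 x -> centralizer G00 [~ g, x].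
Proof.
move=> Gg; have [s [U [GU Gs s1 cover]]] := conjugates_cover_nbhd Gg.
have ZG := @centralizer_subgroup _ G00.
pose P := [set x | G00 x /\ centralizer G00 [~ g, x]].
suff GP : G00 `<=` P by move=> /GP[].
(* For [y] in [P] the representative of [y] is equivalent to [1], hence equal to [1], and the cover
   then speaks of [[~ g, y]] itself. *)
have PU y : P y -> forall w, U w -> commute [~ g, y] w.
  move=> [Gy Zy]; have [i siU] := cover y Gy.
  suff s_1 : nth 1 s i = 1 by move: siU; rewrite s_1 conjg1.
  apply: s1; rewrite /same_conj conjg1.
  have -> : (g ^ nth 1 s i)^-1 * g = ((g ^ nth 1 s i)^-1 * g ^ y) * [~ g, y]^-1.
    have E (a b c : gT) : a^-1 * c = a^-1 * b * (c^-1 * b)^-1.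
      by rewrite invgM invgK mulgA mulgK.
    exact: E.
  by apply: (subgroupM ZG); [move=> w /GU.2; exact: siU|exact: (subgroupV ZG)].
pose S := [set g]; have Ss : small K S by exact/small_finite/finite_set1.
have Eb := with_pts_base S.
have Pg : Defs.subgroup P by exact: commg_centralizer_subgroup.
apply: (G00_min (with_pts_small Ss) Eb _ Pg).
- move=> y yU.
  have Gy : G00 y.
    by apply: G00_td => W /(nbhd_with_pts S)[Wd GW]; apply: yU; split=> // z [/GW].
  split=> // w /GU.2; apply: (yU [set y | forall w, U w -> commute [~ g, y] w]).
  split; last exact: PU.
  apply: (@gdef_iff _ _ _ _ _ _ _ [set y | ~ exists w, U w /\ ~ commute [~ g, y tt] w]).
    move=> z /=; split=> [no v Uv|all [v [Uv]]]; last by case; exact: all.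
    by apply: contrapT => nc; apply: no; exists v.
  apply: gdefC; apply: (gdef_ex Eb (R := fun y w => U w /\ ~ commute [~ g, y tt] w)).
  have [Ud _] := nbhd_with_pts S GU.
  apply: gdefI; first by apply: gdef_app => //; exact: gfun_proj.
  apply: gdefC; apply: gdef_commute => //; last exact: gfun_proj.
  by apply: gfun_comm => //; [exact: gfun_pts|exact: gfun_proj].
- by move=> y [/G00_sub].
have [r rP] : {r : set gT -> gT & forall X, X !=set0 -> X (r X)}.
  apply: (@choice _ _ (fun X r => X !=set0 -> X r)) => X.
  by have [[y Xy]|no] := EM (X !=set0); [exists y|exists 1 => /no].
(* A coset of [P] in [G] is determined by the coset of [G00] that contains it and an index in
   [s]. *)
pose F (Xi : cosets G G00 * nat) : set gT :=
  [set r (val Xi.1) * (nth 1 s Xi.2)^-1 * p | p in P].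
apply: (@small_sub _ _ _ (range F)); last first.
  by apply: small_image; apply: smallT_prod => //; exact: smallT_set.
move=> _ [h Gh <-].
have hX : cosets G G00 [set h * x | x in G00] by exists h.
have [k Gk hk] : [set h * x | x in G00] (r [set h * x | x in G00]).
  by apply: rP; exists h, 1; [exact: subgroup1|rewrite mulg1].
have [i siU] := cover k Gk.
exists (SigSub (mem_set hX), i : nat) => //=; rewrite /F /= -hk.
apply/esym; apply: coset_eq => //.
have -> : h^-1 * (h * k * (nth 1 s i)^-1) = k * (nth 1 s i)^-1.
  by rewrite !mulgA mulVg mul1g.
have Gsk : G00 (k * (nth 1 s i)^-1) by apply: subgroupM => //; exact: subgroupV.
split=> //; rewrite commgEl conjgM.
have -> : g^-1 * (g ^ k) ^ (nth 1 s i)^-1 =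
    ((g ^ nth 1 s i)^-1 * g ^ k) ^ (nth 1 s i)^-1.
  by rewrite (divJg (g ^ nth 1 s i)) conjgK.
apply: centralizerJ => //; last exact: subgroupV.
by move=> w /GU.2; exact: siU.
Qed.

(** Otherwise compactness yields an element of [G] outside [s * U] for every [s] in a small set of
    coset representatives of [G00], although it lies in one of the cosets [s * G00]. *)
Lemma finite_cover U : nbhd D A G00 U ->
  exists2 s : seq gT, forall i, G (nth 1 s i) &
    forall y, G y -> exists i, U ((nth 1 s i)^-1 * y).
Proof.
move=> [Ud GU]; apply: contrapT => no.
have [r rP] : {r : set gT -> gT & forall X, X !=set0 -> X (r X)}.
  apply: (@choice _ _ (fun X r => X !=set0 -> X r)) => X.
  by have [[y Xy]|nX] := EM (X !=set0); [exists y|exists 1 => /nX].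
(* The element [1] is added because it is the default of [nth]. *)
pose S := r @` cosets G G00 `|` [set 1].
have Ss : small K S.
  by apply: small_setU => //; [exact: small_image|exact/small_finite/finite_set1].
have SG : S `<=` G.
  move=> _ [[_ [h Gh <-] <-]|->]; last exact: subgroup1.
  have [k Gk <-] : [set h * x | x in G00] (r [set h * x | x in G00]).
    by apply: rP; exists h, 1; [exact: subgroup1|rewrite mulg1].
  by apply: subgroupM => //; exact: G00_sub.
have Eb := with_pts_base S.
have [||||y yP] := @gsat _ _ _ _ D K sat_C unit (set gT * seq gT)
  [set Ws | nbhd D A G Ws.1 /\ forall i, S (nth 1 Ws.2 i)]
  (fun Ws => [set y | Ws.1 (y tt) /\ forall i : 'I_(size Ws.2).+1,
      ~ U ((nth 1 Ws.2 i)^-1 * y tt)]) (with_pts S) (with_pts_small Ss) Eb.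
- exists (setT, [::]); split; first exact: nbhdT.
  by move=> i; rewrite nth_nil; right.
- move=> [W s] [/(nbhd_with_pts S)[Wd _] /= sS].
  apply: gdefI; first by apply: gdef_app => //; exact: gfun_proj.
  apply: gdef_forall => i; apply: gdefC; apply: gdef_app => //.
    by apply: gdef_sub Ud => c; left.
  by apply: gfun_mul => //; [exact/gfun_inv/gfun_pts/sS|exact: gfun_proj].
- move=> [W s] [W' s'] [/= GW sS] [/= GW' s'S]; exists (W `&` W', s ++ s').
    split; first exact: nbhdI.
    by move=> i; rewrite nth_cat; case: ifP.
  move=> y [[Wy W'y]] /= nU.
  have nU' i : ~ U ((nth 1 (s ++ s') i)^-1 * y tt).
    have [i_lt|i_ge] := ltnP i (size (s ++ s')).
      by have := nU (Ordinal (ltnW i_lt : (i < (size (s ++ s')).+1)%N)).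
    rewrite nth_default // -(nth_default 1 (leqnn (size (s ++ s')))).
    exact: nU ord_max.
  split; split=> // i Ui.
    have [i_lt|i_ge] := ltnP i (size s).
      by apply: (nU' i); rewrite nth_cat i_lt.
    apply: (nU' (size (s ++ s'))); rewrite nth_default//.
    by move: Ui; rewrite nth_default.
  by apply: (nU' (size s + i)%N); rewrite nth_cat ltnNge leq_addr addKn.
- move=> [W s] [[_ GW] sS]; apply: contrapT => noW; apply: no; exists s.
    by move=> i; exact/SG/sS.
  move=> y Gy; apply: contrapT => nU; apply: noW; exists (fun=> y); split; first exact: GW.
  by move=> i Ui; apply: nU; exists i.
have Gy : G (y tt).
  apply: G_td => W GW; have [|] := yP (W, [::]) => //.
  by split=> // i; rewrite nth_nil; right.
have [k Gk yk] : [set y tt * x | x in G00] (r [set y tt * x | x in G00]).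
  by apply: rP; exists (y tt), 1; [exact: subgroup1|rewrite mulg1].
have [|_ /(_ ord0) /=] := yP (setT, [:: y tt * k]).
  split; first exact: nbhdT.
  move=> [|i] /=; last by rewrite nth_nil; right.
  by left; exists [set y tt * x | x in G00] => //; exists (y tt).
by apply; apply: GU; rewrite invgM mulgVK; exact: subgroupV.
Qed.

Lemma nilpotent_by_finite : nilpotent_by_finite_class_le 2 G.
Proof.
have [|||U GU UP] := @nbhd_shrink _ _ _ _ D K sat_C (option bool) A A G00
  [set h | commute [~ h None, h (Some true)] (h (Some false))] A_small _ A_base G00_td _.
- by [].
- by apply: gdef_commute => //; [apply: gfun_comm => //|]; exact: gfun_proj.
- by move=> h hG; apply: commutator_central.
(* [U] need not lie in [G]. The intersection generates a subgroup of [G], and the translates of [U]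
   by [s] still bound its index. *)
pose V := U `&` G; have [s sG cover] := finite_cover GU.
have Hg := @gen_subgroup_subgroup _ V.
exists (gen_subgroup V); split => //.
- by apply: gen_min => // x [].
- apply: (@sub_finite_set _ _ ((fun x => [set x * h | h in gen_subgroup V]) @`
      range (fun i : 'I_(size s).+1 => nth 1 s i))).
    move=> _ [h Gh <-]; have [i Ui] := cover h Gh.
    exists (nth 1 s i).
      have [i_lt|i_ge] := ltnP i (size s).
        by exists (Ordinal (ltnW i_lt : (i < (size s).+1)%N)).
      by exists ord_max => //=; rewrite !nth_default.
    apply: coset_eq => //; apply: sub_gen; split=> //.
    by apply: subgroupM => //; exact: subgroupV.
  by do 2!apply: finite_image; exact: finite_finset.
- apply: gen_class2 => x y z [Ux _] [Uy _] [Uz _].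
  by apply: (UP (fun o => if o is Some b then if b then y else z else x)) => -[[]|].
Qed.

End Main.

Theorem theorem1 (L : language) (T : set (formula L void)) (K : Type)
    (C : structure L) (gT : groupType) (n : nat)
    (D : definable_group C gT n) (G G00 : set gT)
    (q : set (formula L ('I_n + C))) :
  complete_theory T -> NIP T -> models C T -> monster K C ->
  type_definable_subgroup K D G -> dp_minimal K D G -> is_G00 K D G G00 ->
  global_type q -> concentrated_on K q (image G00 (pt D)) ->
  global_bi_f_generic K D G q -> non_torsion_type D q ->
  nilpotent_by_finite_class_le 2 G.
Proof.
move=> _ _ _ [L_small K_limit sat_C _] [G_subgroup _] [B [B_small B_def dp_min]].
move=> [[[G00_subgroup [A0 A0_small A0_def]] G00_sub G00_index] G00_min].
move=> q_type q_conc [q_generic _] q_nontorsion.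
have nat_small := nat_small_of_language L_small.
have B_base : gbase D B by case: B_def.
have GB_td : gtd D B G by apply: type_definable_gtd; case: B_def.
have [m [m_gt0 G_commute]] := dp_minimal_commute sat_C K_limit nat_small B_small B_base
  GB_td G_subgroup dp_min.
(* Both [G] and [G00] are type-definable over the union, whereas dp-minimality is only given over
   [B]. *)
have A_small : small K (B `|` A0) by exact: small_setU.
have A_base : gbase D (B `|` A0) by apply: gbase_sub B_base => c; left.
have G_td : gtd D (B `|` A0) G by apply: gtd_sub GB_td => c; left.
have G00_td : gtd D (B `|` A0) G00.
  have A0_td : gtd D A0 G00 by apply: type_definable_gtd; case: A0_def.
  by apply: gtd_sub A0_td => c; right.
apply: (nilpotent_by_finite sat_C K_limit L_small q_type q_conc q_generic q_nontorsion
  G_subgroup G00_subgroup G00_sub G00_index _ A_small A_base G_td G00_td m_gt0 G_commute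
  B_small B_base GB_td dp_min).
move=> H E E_small E_base Htd Hg HG H_index; apply: G00_min; split=> //; split=> //.
by exists E => //; case: E_base => dE mE; split=> //; exact: gtd_type_definable.
Qed.
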